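(* Let $\mathbb{K}$ be a field of characteristic zero and $n\geq 3$. Let $D$ be a triangular locally nilpotent $\mathbb{K}$-derivation of $\mathbb{K}[x_1,\ldots,x_n]$, and let $F\in\ker D$. Then $\exp(FD)$ is either affine or co-tame.
   Context: $\mathrm{GA}_n(\mathbb{K})$ is the group of polynomial automorphisms of $\mathbb{A}^n_{\mathbb{K}}$. An element $\phi$ is written $\phi=(H_1,\ldots,H_n)$ with $H_i=(x_i)\phi\in\mathbb{K}[x_1,\ldots,x_n]$; for a polynomial $P$ one writes $(P)\phi=P(H_1,\ldots,H_n)$, and composition satisfies $(P)(\phi\psi)=((P)\phi)\psi$. $\mathrm{Aff}_n(\mathbb{K})$ is the affine subgroup (automorphisms all of whose components have degree one). $\mathrm{BA}_n(\mathbb{K})$ is the subgroup of triangular automorphisms $(u_1x_1+P_1,u_2x_2+P_2(x_1),\ldots,u_nx_n+P_n(x_1,\ldots,x_{n-1}))$ with $u_i\in\mathbb{K}^*$ and $P_i\in\mathbb{K}[x_1,\ldots,x_{i-1}]$. $\mathrm{TA}_n(\mathbb{K})=\langle \mathrm{Aff}_n(\mathbb{K}),\mathrm{BA}_n(\mathbb{K})\rangle$ is the tame subgroup. An automorphism $\phi\in\mathrm{GA}_n(\mathbb{K})$ is co-tame if $\mathrm{TA}_n(\mathbb{K})\subset\langle \phi,\mathrm{Aff}_n(\mathbb{K})\rangle$. A derivation $D$ of $\mathbb{K}[x_1,\ldots,x_n]$ is triangular if $D(x_i)\in\mathbb{K}[x_1,\ldots,x_{i-1}]$ for each $i$. If $D$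 is locally nilpotent and $F\in\ker D$, then $FD$ is also locally nilpotent. For a locally nilpotent derivation $E$, $\exp(E)\in\mathrm{GA}_n(\mathbb{K})$ is given by $(x_r)(\exp(E))=\sum_{i\geq 0}\frac{1}{i!}E^i(x_r)$. *)

(* Defs.v *)
From HB Require Import structures.
From mathcomp Require Import all_boot all_order all_algebra.
From mathcomp Require Export mpoly.

Set Implicit Arguments.
Unset Strict Implicit.
Unset Printing Implicit Defensive.

Import GRing.Theory.
Local Open Scope ring_scope.

(* Variables are indexed from 0: 'X_i with i : 'I_n stands for x_{i+1}. *)

Section PolynomialAutomorphisms.

Variables (K : fieldType) (n : nat).

(* The tuple (H_1, ..., H_n) represents the endomorphism phi of the polynomial
   ring with (x_i)phi = H_i, so that (P)phi is P \mPo phi. *)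
Definition endo := n.-tuple {mpoly K[n]}.

Definition endo_id : endo := [tuple 'X_i | i < n].

(* Endomorphisms act on the right: (P)(phi psi) = ((P)phi)psi. *)
Definition endo_comp (phi psi : endo) : endo :=
  [tuple tnth phi i \mPo psi | i < n].

Definition endo_inverse (phi psi : endo) : Prop :=
  endo_comp phi psi = endo_id /\ endo_comp psi phi = endo_id.

Definition GA (phi : endo) : Prop := exists psi, endo_inverse phi psi.

(* The subgroup of GA_n(K) generated by S, meaningful when S is contained in
   GA_n(K). *)
Inductive generated (S : endo -> Prop) : endo -> Prop :=
| generated_mem phi : S phi -> generated S phi
| generated_id : generated S endo_id
| generated_comp phi psi :
    generated S phi -> generated S psi -> generated S (endo_comp phi psi)
| generated_inv phi psi :
    generated S phi -> endo_inverse phi psi -> generated S psi.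

(* [msize p] is 1 + the total degree of p (and 0 for p = 0). *)
Definition Aff (phi : endo) : Prop :=
  GA phi /\ forall i, msize (tnth phi i) = 2%N.

(* p involves only the variables 'X_j with j < i; for i : 'I_n this is
   membership in K[x_1, ..., x_i], where 'X_i itself is x_{i+1}. *)
Definition in_first_vars (i : nat) (p : {mpoly K[n]}) : Prop :=
  forall m, m \in msupp p -> forall j : 'I_n, (i <= j)%N -> m j = 0%N.

Definition BA (phi : endo) : Prop :=
  exists (u : 'I_n -> K) (P : 'I_n -> {mpoly K[n]}), forall i : 'I_n,
    [/\ u i != 0, in_first_vars i (P i) & tnth phi i = u i *: 'X_i + P i].

Definition TA : endo -> Prop := generated (fun phi => Aff phi \/ BA phi).

Definition cotame (phi : endo) : Prop :=
  GA phi /\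
  forall psi, TA psi -> generated (fun theta => theta = phi \/ Aff theta) psi.

End PolynomialAutomorphisms.

Section Derivations.

Variables (K : fieldType) (n : nat).

(* The Leibniz rule; K-linearity is part of the type of D. *)
Definition derivation (D : {linear {mpoly K[n]} -> {mpoly K[n]}}) : Prop :=
  forall p q, D (p * q) = D p * q + p * D q.

Definition triangular (D : {mpoly K[n]} -> {mpoly K[n]}) : Prop :=
  forall i : 'I_n, in_first_vars i (D 'X_i).

Definition locally_nilpotent (D : {mpoly K[n]} -> {mpoly K[n]}) : Prop :=
  forall p, exists m, iter m D p == 0.

Lemma locally_nilpotent_mul (D : {linear {mpoly K[n]} -> {mpoly K[n]}})
    (F : {mpoly K[n]}) :
  derivation D -> locally_nilpotent D -> D F = 0 ->
  locally_nilpotent (F \*o D).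
Proof.
move=> derD nilD DF0 p; have [m /eqP Dm0] := nilD p; exists m.
have DFX k : D (F ^+ k) = 0.
  elim: k => [|k IH]; last by rewrite exprS derD DF0 IH mul0r mulr0 addr0.
  rewrite expr0; have := derD 1 1; rewrite !mulr1 mul1r => D1.
  by apply: (addrI (D 1)); rewrite -D1 addr0.
suff -> : iter m (F \*o D) p = F ^+ m * iter m D p by rewrite Dm0 mulr0.
elim: m {Dm0} => [|m IH]; first by rewrite expr0 mul1r.
by rewrite !iterS IH /= derD DFX mul0r add0r exprS mulrA.
Qed.

(* The series sum_i E^i(x_r) / i! is truncated at the least m such that
   E^m(x_r) = 0; for linear E all later terms vanish. *)
Definition exp_endo (E : {mpoly K[n]} -> {mpoly K[n]})
    (nilE : locally_nilpotent E) : endo K n :=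
  [tuple \sum_(i < ex_minn (nilE 'X_r)) (i`!%:R)^-1 *: iter i E 'X_r | r < n].

End Derivations.

(* Main.v *)
Require Import Defs.
From HB Require Import structures.
From mathcomp Require Import all_boot all_order all_algebra.
From mathcomp Require Import perm mpoly ring zify.

(* Let G be the group generated by phi = exp(FD) and the affine automorphisms.

   If G contains a shear x_i |-> x_i + P with P of degree > 1, then G contains all
   tame automorphisms. Indeed, the P that occur for a given i form a vector space
   stable under d/dx_j and x_k d/dx_j (conjugate by affine maps), which therefore
   contains all quadratic monomials; conjugating x_i |-> x_i + x_k x_a by
   x_a |-> x_a + x_k^d then raises the degree of x_k^d, and all monomials follow.

   Let W be the additive group of the H in ker D with exp(HD) in G, and z the last
   variable. If f in W does not involve z, conjugating the shears z |-> z + x_j by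
   the exp(mfD) shows that f D(x_j) is of degree at most 1 for all j, unless G is
   as above. In general, taking differences along z |-> z + 1 gives an element
   F = e z + g of W with e and g free of z and e in W; so either all D(x_i) are
   constant and exp(FD) is linearly conjugate to a shear, or e is a constant and
   the D(x_i) are of degree at most 1.

   In this last case, if D kills a nonconstant affine form h in the variables
   before z, then z |-> z + h commutes with D and yields e h in W. Otherwise D acts
   on those affine forms as a single Jordan block. The composite Theta of exp(FD)
   and a suitable affine shear conjugates shears along z to exponentials of
   multiples of D, so that W contains the line through F and the line through
   N = f + k F^2, where f involves x_1 and x_2 only. An affine dilation T with
   weights 2, 4, 8, ... satisfies DT = 2TD, so W is stable under T, and one of
   T F - 2^n F and T N - 4^n N - c F is nonconstant and free of z. *)

Set Implicit Arguments.
Unset Strict Implicit.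
Unset Printing Implicit Defensive.

Import GRing.Theory.
Local Open Scope ring_scope.

(** * Algebra endomorphisms and derivations along them, determined by their values on the
    variables *)

Section Endomorphisms.

Variables (K : fieldType) (n : nat).
Local Notation A := {mpoly K[n]}.

(** A predicate on plain functions, so that automorphisms compose and invert as functions; [tup]
    goes back to tuples. *)
Record algmor (f : A -> A) : Prop := Algmor {
  algmorD : {morph f : p q / p + q};
  algmorZ : forall c, {morph f : p / c *: p};
  algmorM : {morph f : p q / p * q};
  algmor1 : f 1 = 1 }.

Definition tup (f : A -> A) : endo K n := [tuple f 'X_i | i < n].

Lemma algmor_mPo (t : endo K n) : algmor (comp_mpoly t).
Proof.
by split; [exact: comp_mpolyD | move=> c p; exact: comp_mpolyZ
  | exact: rmorphM | exact: comp_mpoly1].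
Qed.

Lemma algmor_id : algmor id.
Proof. by split. Qed.

Lemma algmor_comp f g : algmor f -> algmor g -> algmor (f \o g).
Proof.
move=> [fD fZ fM f1] [gD gZ gM g1]; split => [p q|c p|p q|] /=.
- by rewrite gD fD.
- by rewrite gZ fZ.
- by rewrite gM fM.
- by rewrite g1 f1.
Qed.

Lemma algmor0 f (fA : algmor f) : f 0 = 0.
Proof. by have := algmorZ fA 0 0; rewrite !scale0r. Qed.

Lemma algmor_sum f (fA : algmor f) (I : Type) (r : seq I) P F :
  f (\sum_(i <- r | P i) F i) = \sum_(i <- r | P i) f (F i).
Proof. exact: (big_morph f (algmorD fA) (algmor0 fA)). Qed.

Lemma algmorXn f (fA : algmor f) p k : f (p ^+ k) = f p ^+ k.
Proof.
by elim: k => [|k IH]; rewrite ?expr0 ?(algmor1 fA) // !exprS (algmorM fA) IH.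
Qed.

Lemma algmorC f (fA : algmor f) c : f c%:MP = c%:MP.
Proof. by rewrite -alg_mpolyC (algmorZ fA) (algmor1 fA). Qed.

Lemma algmorN f (fA : algmor f) p : f (- p) = - f p.
Proof. by rewrite -scaleN1r (algmorZ fA) scaleN1r. Qed.

Lemma algmorB f (fA : algmor f) p q : f (p - q) = f p - f q.
Proof. by rewrite (algmorD fA) (algmorN fA). Qed.

Lemma mpoly_X_ind (P : A -> Prop) :
  (forall c, P c%:MP) -> (forall p q, P p -> P q -> P (p + q)) ->
  (forall i p, P p -> P ('X_i * p)) -> forall p, P p.
Proof.
move=> PC PD PX; elim/mpolyind=> [|c m p _ _ Pp]; first exact: (PC 0).
apply: PD => //; rewrite -mul_mpolyC mpolyXE_id.
have step j : P c%:MP ->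
    forall s : seq 'I_n, P (c%:MP * \prod_(i <- s) 'X_i ^+ j i).
  move=> P1; elim=> [|i s IH]; first by rewrite big_nil mulr1.
  rewrite big_cons; elim: (j i) => [|k IHk]; first by rewrite expr0 mul1r.
  by rewrite exprS -mulrA mulrCA; apply: PX.
exact: step.
Qed.

Lemma algmor_ext f g : algmor f -> algmor g ->
  (forall i, f 'X_i = g 'X_i) -> f =1 g.
Proof.
move=> fA gA fg; elim/mpoly_X_ind=> [c|p q IHp IHq|i p IH].
- by rewrite !algmorC.
- by rewrite (algmorD fA) (algmorD gA) IHp IHq.
- by rewrite (algmorM fA) (algmorM gA) IH fg.
Qed.

(* [d] is a derivation from A to A, the latter seen as an A-module through f. *)
Record alongder (f d : A -> A) : Prop := Alongder {
  alongderD : {morph d : p q / p + q};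
  alongderZ : forall c, {morph d : p / c *: p};
  alongderM : forall p q, d (p * q) = d p * f q + f p * d q }.

Lemma alongderC f d c : algmor f -> alongder f d -> d c%:MP = 0.
Proof.
move=> fA dA; rewrite -alg_mpolyC (alongderZ dA).
suff -> : d 1 = 0 by rewrite scaler0.
have := alongderM dA 1 1; rewrite mulr1 (algmor1 fA) mulr1 mul1r => d1.
by apply: (addrI (d 1)); rewrite -d1 addr0.
Qed.

Lemma alongder_ext f d e : algmor f -> alongder f d -> alongder f e ->
  (forall i, d 'X_i = e 'X_i) -> d =1 e.
Proof.
move=> fA dA eA de; elim/mpoly_X_ind=> [c|p q IHp IHq|i p IH].
- by rewrite !(alongderC c fA).
- by rewrite (alongderD dA) (alongderD eA) IHp IHq.
- by rewrite (alongderM dA) (alongderM eA) IH de.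
Qed.

Lemma tup_mPo f : algmor f -> comp_mpoly (tup f) =1 f.
Proof.
move=> fA; apply: algmor_ext => //; first exact: algmor_mPo.
by move=> i; rewrite comp_mpolyXU -tnth_nth tnth_mktuple.
Qed.

(** Tuples act on the right, so the product of [tup g] and [tup f] applies [g] first. *)
Lemma tup_comp f g : algmor f -> endo_comp (tup g) (tup f) = tup (f \o g).
Proof.
move=> fA; apply: eq_from_tnth => i; rewrite !tnth_mktuple.
exact: tup_mPo.
Qed.

Lemma tup_id : tup id = @endo_id K n.
Proof. by []. Qed.

Lemma eq_tup f g : f =1 g -> tup f = tup g.
Proof. by move=> fg; apply: eq_from_tnth => i; rewrite !tnth_mktuple fg. Qed.

Lemma tup_inverse f g : algmor f -> algmor g -> cancel f g -> cancel g f ->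
  endo_inverse (tup f) (tup g).
Proof.
move=> fA gA fK gK; split; rewrite tup_comp // -tup_id; exact: eq_tup.
Qed.

End Endomorphisms.

Lemma natr_neq0 (K : fieldType) (charK0 : [pchar K] =i pred0) m :
  (m%:R == 0 :> K) = (m == 0)%N.
Proof. by rewrite (pcharf0P _).1. Qed.

Lemma natr_inj (K : fieldType) (charK0 : [pchar K] =i pred0) :
  injective (fun m => m%:R : K).
Proof.
move=> a b; wlog leab : a b / (a <= b)%N => [hwlog|/eqP].
  by case: (leqP a b) => [/hwlog|/ltnW/hwlog h /esym/h].
rewrite eq_sym -subr_eq0 -natrB // natr_neq0 // => ba.
by apply/eqP; rewrite eqn_leq leab.
Qed.

(** * Exponentials of locally nilpotent derivations *)

Section Exponential.

Variables (K : fieldType) (n : nat).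
Hypothesis charK0 : [pchar K] =i pred0.
Local Notation A := {mpoly K[n]}.

Lemma derivation_alongder (D : {linear A -> A}) : derivation D -> alongder id D.
Proof.
by move=> derD; split => [p q|c p|p q]; rewrite ?linearD ?linearZ ?derD.
Qed.

Lemma derivationC (D : {linear A -> A}) c : derivation D -> D c%:MP = 0.
Proof. move=> /derivation_alongder; exact: alongderC (algmor_id _ _). Qed.

Lemma derivationX0 (D : {linear A -> A}) p k :
  derivation D -> D p = 0 -> D (p ^+ k) = 0.
Proof.
move=> derD Dp0; elim: k => [|k IH].
  by rewrite expr0 -mpolyC1 derivationC.
by rewrite exprS derD Dp0 IH mul0r mulr0 addr0.
Qed.

Lemma mderiv_derivation i : derivation (@mderiv n K i).
Proof. exact: mderivM. Qed.

Lemma iterD_add (D : {linear A -> A}) k p q :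
  iter k D (p + q) = iter k D p + iter k D q.
Proof. by elim: k => //= k ->; rewrite linearD. Qed.

Lemma iterD_scale (D : {linear A -> A}) k c p :
  iter k D (c *: p) = c *: iter k D p.
Proof. by elim: k => //= k ->; rewrite linearZ. Qed.

Lemma iterD0 (D : {linear A -> A}) k : iter k D 0 = 0.
Proof. by elim: k => //= k ->; rewrite linear0. Qed.

Lemma iterD_ge (D : {linear A -> A}) k N p : iter N D p = 0 -> (N <= k)%N ->
  iter k D p = 0.
Proof. by move=> DN /subnK <-; rewrite iterD DN iterD0. Qed.

Lemma mderiv_nilpotent i : locally_nilpotent (@mderiv n K i).
Proof.
elim/mpolyind=> [|c m p _ _ [N /eqP IH]]; first by exists 0%N.
exists (maxn N (m i).+1); apply/eqP.
rewrite iterD_add iterD_scale (iterD_ge IH) ?leq_maxl // addr0.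
rewrite (@iterD_ge _ _ (m i).+1) ?leq_maxr ?scaler0 //.
by rewrite -mderivn_iter mderivnX ffact_small // scale0r.
Qed.

Section Series.

Variables (D : {linear A -> A}) (nilD : locally_nilpotent D).
Hypothesis derD : derivation D.

Definition divD k p : A := (k`!%:R)^-1 *: iter k D p.

Lemma divD0 p : divD 0 p = p.
Proof. by rewrite /divD fact0 invr1 scale1r. Qed.

Lemma divDS k p : k.+1%:R *: divD k.+1 p = D (divD k p).
Proof.
rewrite /divD scalerA factS natrM invfM mulrA divff ?natr_neq0 // mul1r.
by rewrite iterS [RHS]linearZ.
Qed.

(** Divided powers obey a Leibniz rule without binomial coefficients. The induction cancels the
    factor k + 1, which is nonzero in characteristic zero. *)
Lemma divDM k p q : divD k (p * q) = \sum_(i < k.+1) divD i p * divD (k - i) q.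
Proof.
elim: k => [|k IH]; first by rewrite big_ord_recr big_ord0 /= add0r !divD0.
have k1 : (k.+1%:R : K) != 0 by rewrite natr_neq0.
apply: (scalerI k1); rewrite divDS IH linear_sum /= scaler_sumr.
under eq_bigr => i _ do rewrite derD -!divDS.
rewrite big_split /=.
(* Both sums are reindexed to the same range, with weights i and k + 1 - i that add up to k + 1; the
   extra boundary terms have weight zero. *)
have -> : \sum_(i < k.+1) (i.+1%:R *: divD i.+1 p) * divD (k - i) q =
    \sum_(i < k.+2) (i%:R *: divD i p) * divD (k.+1 - i) q.
  by rewrite [RHS]big_ord_recl /= scale0r mul0r add0r.
have -> : \sum_(i < k.+1) divD i p * ((k - i).+1%:R *: divD (k - i).+1 q) =
    \sum_(i < k.+2) divD i p * ((k.+1 - i)%:R *: divD (k.+1 - i) q).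
  rewrite [RHS]big_ord_recr /= subnn scale0r mulr0 addr0.
  by apply: eq_bigr => i _; rewrite subSn // -ltnS.
rewrite -big_split /=; apply: eq_bigr => i _.
rewrite -(scalerAl i%:R) -(scalerAr (k.+1 - i)%:R) -scalerDl -natrD subnKC //.
by rewrite -ltnS.
Qed.

(* [expD H] is substitution of t := H in the morphism exp(tD) : A -> A[t]. *)
Definition expP p : {poly A} := \poly_(k < ex_minn (nilD p)) divD k p.

Definition expD (H : A) p := (expP p).[H].

Lemma coef_expP p k : (expP p)`_k = divD k p.
Proof.
rewrite coef_poly; case: ltnP => //; case: ex_minnP => N /eqP DN _ leNk.
by rewrite /divD (iterD_ge DN leNk) scaler0.
Qed.

Lemma expP_size N p : iter N D p = 0 -> (size (expP p) <= N)%N.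
Proof.
move=> DN; apply/leq_sizeP => j leNj.
by rewrite coef_expP /divD (iterD_ge DN leNj) scaler0.
Qed.

Lemma expDE N H p : iter N D p = 0 ->
  expD H p = \sum_(k < N) divD k p * H ^+ k.
Proof.
move=> DN; rewrite /expD (horner_coef_wide _ (expP_size DN)).
by apply: eq_bigr => i _; rewrite coef_expP.
Qed.

Lemma algmor_expD H : algmor (expD H).
Proof.
split=> [p q|c p|p q|]; rewrite /expD.
- rewrite -hornerD; congr (_.[_]); apply/polyP => k.
  by rewrite coefD !coef_expP /divD iterD_add scalerDr.
- have -> : expP (c *: p) = (c%:MP)%:P * expP p.
    apply/polyP=> k; rewrite coefCM !coef_expP /divD iterD_scale mul_mpolyC.
    by rewrite !scalerA mulrC.
  by rewrite hornerM hornerC mul_mpolyC.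
- rewrite -hornerM; congr (_.[_]); apply/polyP => k.
  rewrite coefM coef_expP divDM; apply: eq_bigr => i _.
  by rewrite !coef_expP.
- suff -> : expP 1 = 1 by rewrite hornerC.
  apply/polyP=> [] [|k]; rewrite coef_expP coef1 /= ?divD0 //.
  by rewrite /divD iterSr -mpolyC1 derivationC // iterD0 scaler0.
Qed.

Lemma expD_ker H p : D p = 0 -> expD H p = p.
Proof.
move=> Dp0; rewrite (@expDE 1) // big_ord_recr big_ord0 /= add0r.
by rewrite divD0 expr0 mulr1.
Qed.

Lemma expD0 p : expD 0 p = p.
Proof. by rewrite /expD horner_coef0 coef_expP divD0. Qed.

(** Chain rule for the substitution t := H in exp(tD)p: the derivative of exp(tD)p in t is exp(tD)(D
    p). *)
Lemma expD_chain (E : {linear A -> A}) H p : derivation E ->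
  (forall q, E (D q) = D (E q)) ->
  E (expD H p) = expD H (E p) + E H * expD H (D p).
Proof.
move=> derE ED; have EDk k q : E (iter k D q) = iter k D (E q).
  by elim: k => //= k <-.
have EX k : E (H ^+ k.+1) = k.+1%:R *: (H ^+ k * E H).
  elim: k => [|k IH]; first by rewrite expr1 expr0 mul1r scale1r.
  rewrite exprS derE IH -[k.+2]addn1 natrD scalerDl scale1r addrC.
  by rewrite -scalerAr mulrA -exprS; congr (_ + _); rewrite mulrC.
have [N /eqP DN] := nilD p.
rewrite (@expDE N.+1); last by rewrite /= DN linear0.
rewrite (@expDE N.+1 _ (E p)); last by rewrite /= -EDk DN linear0 linear0.
rewrite (@expDE N _ (D p)); last by rewrite -iterSr /= DN linear0.
rewrite linear_sum mulr_sumr /=; under eq_bigr => k _ do rewrite derE.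
rewrite big_split /=; congr (_ + _).
  by apply: eq_bigr => k _; rewrite /divD linearZ /= EDk.
rewrite big_ord_recl /= expr0 -mpolyC1 (derivationC _ derE) mulr0 add0r.
apply: eq_bigr => k _; rewrite EX -scalerAr scalerAl divDS.
have -> : divD k (D p) = D (divD k p) by rewrite /divD [RHS]linearZ /= -iterSr.
ring.
Qed.

Lemma expD_derivation (E : {linear A -> A}) H p : derivation E ->
  (forall q, E (D q) = D (E q)) -> E H = 0 -> E (expD H p) = expD H (E p).
Proof. by move=> derE ED EH; rewrite expD_chain // EH mul0r addr0. Qed.

Lemma expD_D H p : D H = 0 -> D (expD H p) = expD H (D p).
Proof. exact: expD_derivation. Qed.

Lemma divD_comp i k p : divD k (divD i p) = divD (k + i) p *+ 'C(k + i, i).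
Proof.
rewrite /divD iterD_scale -iterD scalerA -scaler_nat scalerA.
congr (_ *: _); rewrite -(bin_fact (leq_addl k i)) addnK !natrM !invfM.
rewrite !mulrA divff ?mul1r 1?mulrC // natr_neq0 //.
by rewrite -lt0n bin_gt0 leq_addl.
Qed.

(** Taylor expansion of exp(tD)p at t = F with increment H: its i-th divided derivative in t is
    exp(tD) of the i-th divided power of D at p, and exp(FD) fixes H. *)
Lemma expD_comp F H p : D H = 0 -> expD F (expD H p) = expD (F + H) p.
Proof.
move=> DH; rewrite [RHS]/expD nderiv_taylor; last exact: mulrC.
rewrite {2}/expD horner_coef (algmor_sum (algmor_expD F)).
apply: eq_bigr => i _; rewrite (algmorM (algmor_expD F)) coef_expP.
rewrite (algmorXn (algmor_expD F)) (expD_ker _ DH); congr (_ * _).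
rewrite /expD; congr (_.[_]); apply/polyP => k.
by rewrite coef_nderivn !coef_expP divD_comp addnC.
Qed.

Lemma expDK H : D H = 0 -> cancel (expD H) (expD (- H)).
Proof. by move=> DH p; rewrite expD_comp // addNr expD0. Qed.

Lemma expDNK H : D H = 0 -> cancel (expD (- H)) (expD H).
Proof. by move=> DH p; rewrite expD_comp ?addrN ?expD0 // linearN /= DH oppr0. Qed.

End Series.

(** The source of all conjugations below: shears into shears, exponentials of D into each other, and
    each kind into the other. *)
Lemma expD_intertwine (D1 D2 : {linear A -> A}) (nil1 : locally_nilpotent D1)
    (nil2 : locally_nilpotent D2) f c H p : algmor f ->
  (forall q, f (D1 q) = c *: D2 (f q)) ->
  f (expD nil1 H p) = expD nil2 (c *: f H) (f p).
Proof.
move=> fA fD; have [N1 /eqP DN1] := nil1 p; have [N2 /eqP DN2] := nil2 (f p).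
rewrite (@expDE _ nil1 (maxn N1 N2)) ?(iterD_ge DN1) ?leq_maxl //.
rewrite (@expDE _ nil2 (maxn N1 N2)) ?(iterD_ge DN2) ?leq_maxr //.
rewrite (algmor_sum fA); apply: eq_bigr => k _.
rewrite (algmorM fA) (algmorXn fA) exprZn /divD (algmorZ fA).
suff -> : f (iter k D1 p) = c ^+ k *: iter k D2 (f p).
  by rewrite -!scalerAl -scalerAr !scalerA.
elim: (k : nat) => [|m IH]; first by rewrite expr0 scale1r.
by rewrite !iterS fD IH linearZ /= scalerA exprS.
Qed.

End Exponential.

(** * Intertwining relations, substitutions and shears *)

Section Shears.

Variables (K : fieldType) (n : nat).
Hypothesis charK0 : [pchar K] =i pred0.
Local Notation A := {mpoly K[n]}.

Lemma alongder_compl (f d : A -> A) : algmor f -> alongder id d -> alongder f (f \o d).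
Proof.
move=> fA dA; split=> [p q|c p|p q] /=.
- by rewrite (alongderD dA) (algmorD fA).
- by rewrite (alongderZ dA) (algmorZ fA).
- by rewrite (alongderM dA) (algmorD fA) !(algmorM fA).
Qed.

Lemma alongder_compr (f : A -> A) d c : algmor f -> alongder id d ->
  alongder f (fun p => c *: d (f p)).
Proof.
move=> fA dA; split=> [p q|e p|p q] /=.
- by rewrite (algmorD fA) (alongderD dA) scalerDr.
- by rewrite (algmorZ fA) (alongderZ dA) !scalerA mulrC.
- by rewrite (algmorM fA) (alongderM dA) scalerDr scalerAl scalerAr.
Qed.

(** Both sides are derivations along f, so they are compared on the variables only. *)
Lemma intertwine_X f (d1 d2 : {linear A -> A}) c : algmor f ->
  derivation d1 -> derivation d2 ->
  (forall i, f (d1 'X_i) = c *: d2 (f 'X_i)) ->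
  forall p, f (d1 p) = c *: d2 (f p).
Proof.
move=> fA /derivation_alongder d1A /derivation_alongder d2A fd.
exact: (alongder_ext fA (alongder_compl fA d1A) (alongder_compr c fA d2A)).
Qed.

(** The commutator of two derivations is a derivation, hence zero once it kills the variables. *)
Lemma derivation_comm (d1 d2 : {linear A -> A}) :
  derivation d1 -> derivation d2 ->
  (forall i, d1 (d2 'X_i) = d2 (d1 'X_i)) ->
  forall p, d1 (d2 p) = d2 (d1 p).
Proof.
move=> der1 der2 comm12 p; apply/eqP; rewrite -subr_eq0; apply/eqP.
have zA : alongder id (fun _ : A => 0 : A).
  by split=> [? ?|? ?|? ?]; rewrite ?addr0 ?scaler0 ?mul0r ?mulr0 ?addr0.
have cA : alongder id (fun p => d1 (d2 p) - d2 (d1 p)).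
  split=> [q r|c q|q r].
  - by rewrite !(linearD d1, linearD d2) opprD addrACA.
  - by rewrite !(linearZ_LR d1, linearZ_LR d2) /= scalerBr.
  - rewrite der1 der2 !(linearD d1, linearD d2) !der1 !der2; ring.
apply: (alongder_ext (algmor_id _ _) cA zA) => i.
by rewrite comm12 subrr.
Qed.

Lemma mderivXU i j : ('X_j : A)^`M(i) = (j == i)%:R.
Proof.
rewrite mderivX mnm1E; case: eqP => [->|_]; last by rewrite scale0r.
rewrite scale1r -[X in 'X_[X]]/(_ - _)%MM -mpolyX0; congr 'X_[_].
by apply/mnmP=> k; rewrite mnmBE subnn mnm0E.
Qed.

Definition subst (t : 'I_n -> A) : A -> A := comp_mpoly [tuple t i | i < n].

Lemma algmor_subst t : algmor (subst t).
Proof. exact: algmor_mPo. Qed.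

Lemma substX t i : subst t 'X_i = t i.
Proof. by rewrite /subst comp_mpolyXU -tnth_nth tnth_mktuple. Qed.

Lemma algmor_cancel (f g : A -> A) : algmor f -> algmor g ->
  (forall i, g (f 'X_i) = 'X_i) -> cancel f g.
Proof. move=> fA gA; apply: algmor_ext (algmor_id _ _); exact: (algmor_comp gA fA). Qed.

(* Sends x_i to x_i + P and fixes the other variables: see shearX. *)
Definition shear i (P : A) := expD (@mderiv_nilpotent K n i) P.

Lemma algmor_shear i P : algmor (shear i P).
Proof. exact: algmor_expD (mderiv_derivation i) P. Qed.

Lemma shearX i P j : shear i P 'X_j = 'X_j + P *+ (j == i).
Proof.
rewrite /shear (@expDE _ _ _ _ 2) /= ?mderivXU ?(mderivC, rmorph_nat) //.
  rewrite 2!big_ord_recr big_ord0 /= add0r divD0 expr0 mulr1 expr1.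
  rewrite /divD /= mderivXU invr1 scale1r.
  by case: eqP => _; rewrite ?mul1r ?mul0r.
by case: eqP => _; rewrite ?mderiv0 // -mpolyC1 mderivC.
Qed.

Lemma shearX_eq i P : shear i P 'X_i = 'X_i + P.
Proof. by rewrite shearX eqxx. Qed.

Lemma shearX_neq i P j : j != i -> shear i P 'X_j = 'X_j.
Proof. by move=> /negPf ji; rewrite shearX ji addr0. Qed.

Lemma shear_free i P p : p^`M(i) = 0 -> shear i P p = p.
Proof. exact: expD_ker. Qed.

Lemma shear_comp i P Q p : Q^`M(i) = 0 ->
  shear i P (shear i Q p) = shear i (P + Q) p.
Proof. exact: expD_comp (mderiv_derivation i) _ _ _. Qed.

Lemma shearK i P : P^`M(i) = 0 -> cancel (shear i P) (shear i (- P)).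
Proof. exact: expDK (mderiv_derivation i) _. Qed.

Lemma shearNK i P : P^`M(i) = 0 -> cancel (shear i (- P)) (shear i P).
Proof. exact: expDNK (mderiv_derivation i) _. Qed.

Lemma shear_conj (f g : A -> A) i j c P : algmor f -> cancel g f ->
  (forall p, f p^`M(i) = c *: (f p)^`M(j)) ->
  forall p, f (shear i P (g p)) = shear j (c *: f P) p.
Proof.
move=> fA gK fd p; rewrite /shear.
rewrite (@expD_intertwine _ _ (mderiv i) (mderiv j) _ (mderiv_nilpotent j) f c) //.
by rewrite gK.
Qed.

Lemma free_X i j : j != i -> ('X_j : A)^`M(i) = 0.
Proof. by move=> /negPf ji; rewrite mderivXU ji. Qed.

(** Stands in for a Vandermonde determinant: it separates the powers of m in a family of elements of
    V that is polynomial in m. *)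
Lemma subspace_coef (V : A -> Prop) : V 0 -> (forall p q, V p -> V q -> V (p + q)) ->
  (forall c p, V p -> V (c *: p)) -> forall N (q : nat -> A),
  (forall m : nat, V (\sum_(k < N) m%:R ^+ k *: q k)) ->
  forall k, (k < N)%N -> V (q k).
Proof.
move=> V0 VD VZ; elim=> [//|N IH] q Vq.
(* If r m is the sum, then r (2 m) - 2^N r m has no term of degree N. *)
have lower k : (k < N)%N -> V (q k).
  move=> ltkN; rewrite -[q k](@scalerK _ _ (2%:R ^+ k - 2%:R ^+ N)); last first.
    rewrite subr_eq0 -!natrX; apply: contraTneq ltkN => /(natr_inj charK0) E.
    by rewrite -leqNgt -(@leq_exp2l 2) // E.
  apply: (VZ); move: k ltkN; apply: (IH (fun k => (2%:R ^+ k - 2%:R ^+ N) *: q k)) => m.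
  have := VD _ _ (Vq (2 * m)%N) (VZ (- 2%:R ^+ N) _ (Vq m)).
  rewrite scaler_sumr -big_split big_ord_recr /=.
  rewrite natrM exprMn [X in _ + X]addrC scalerA mulNr.
  rewrite [X in _ + X](_ : _ = 0) ?addr0; last by rewrite -scalerDl addNr scale0r.
  congr V; apply: eq_bigr => k _.
  by rewrite !scalerA -scalerDl exprMn; congr (_ *: _); ring.
move=> k; rewrite ltnS leq_eqVlt => /predU1P[->|/lower //].
have := Vq 1%N; rewrite big_ord_recr /= expr1n scale1r => V1.
have -> : q N = (\sum_(i < N) 1%:R ^+ i *: q i + q N) +
    (- 1) *: \sum_(i < N) 1%:R ^+ i *: q i by rewrite scaleN1r addrAC subrr add0r.
apply/VD/VZ => //.
elim/big_rec: _ => // i x _ Vx; apply: VD => //.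
by rewrite expr1n scale1r; apply: lower.
Qed.

End Shears.

(** * Degrees, dilations, and the shears in a group that contains the affine automorphisms *)

Section AffineGenerated.

Variables (K : fieldType) (n : nat).
Hypothesis charK0 : [pchar K] =i pred0.
Local Notation A := {mpoly K[n]}.

Lemma msizeD_max (p q : A) k :
  (msize p <= k)%N -> (msize q <= k)%N -> (msize (p + q) <= k)%N.
Proof. by move=> pk qk; apply: leq_trans (mmeasureD_le _ _ _) _; rewrite geq_max pk. Qed.

Lemma msizeXU i : msize ('X_i : A) = 2.
Proof. by rewrite msizeX mdeg1. Qed.

Lemma msize_mderiv (p : A) i : (msize p^`M(i) <= (msize p).-1)%N.
Proof.
rewrite [X in (X <= _)%N]msizeE; apply/bigmax_leqP_seq => m mp _.
rewrite mcoeff_msupp mcoeff_mderiv in mp.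
have : (m + U_(i))%MM \in msupp p.
  by rewrite mcoeff_msupp; apply: contraNneq mp => ->; rewrite mul0rn.
by move=> /msize_mdeg_lt; rewrite mdegD mdeg1 addn1; case: (msize p).
Qed.

Lemma free_supp (p : A) i m : p^`M(i) = 0 -> m \in msupp p -> m i = 0%N.
Proof.
move=> pi0 mp; apply/eqP; apply: contraTT mp => mi.
have mE : (m = (m - U_(i)) + U_(i))%MM by rewrite submK // lep1mP.
have := mcoeff_mderiv i p (m - U_(i))%MM; rewrite -mE pi0 mcoeff0 -mulr_natr.
move/esym/eqP; rewrite mulf_eq0 natr_neq0 // orbF mcoeff_eq0.
by move=> h; rewrite h.
Qed.

Lemma mcoeff_XM i (p : A) m :
  ('X_i * p)@_m = if m i == 0%N then 0 else p@_(m - U_(i)).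
Proof.
rewrite mulrC; case: eqP => [mi|/eqP mi]; last first.
  by rewrite -[in LHS](@submK _ U_(i)%MM m) ?lep1mP // addmC mcoeffMX.
apply/eqP; rewrite mcoeff_eq0 (perm_mem (msuppMX _ _)).
by apply/mapP => -[m' _ E]; move: mi; rewrite E mnmDE mnm1E eqxx.
Qed.

(** Scaling of x_i by c, written as a shear so that [inV_taylor] covers it as well. *)
Definition dilation i (c : K) : A -> A := shear i ((c - 1) *: 'X_i).

Lemma algmor_dilation i c : algmor (dilation i c).
Proof. exact: algmor_shear. Qed.

Lemma dilationX i c j : dilation i c 'X_j = (if j == i then c else 1) *: 'X_j.
Proof.
rewrite /dilation shearX //; case: eqP => [->|_]; last by rewrite addr0 scale1r.
by rewrite mulr1n scalerBl scale1r addrC subrK.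
Qed.

Lemma dilationK i c d : d * c = 1 -> cancel (dilation i c) (dilation i d).
Proof.
move=> dc; apply: algmor_cancel; try exact: algmor_dilation.
move=> j; rewrite dilationX (algmorZ (algmor_dilation i d)) dilationX scalerA.
by case: eqP => _; rewrite ?mulr1 1?mulrC ?dc ?scale1r.
Qed.

(* In the theorem, S consists of the given automorphism and the affine ones. *)
Variables (S : endo K n -> Prop).
Hypothesis affS : forall theta, Aff theta -> S theta.

Definition inG (f : A -> A) := algmor f /\ generated S (tup f).

Lemma eq_inG f g : f =1 g -> inG f -> inG g.
Proof.
move=> fg [[fD fZ fM f1] Sf]; split; last by rewrite -(eq_tup fg).
by split=> [p q|c p|p q|]; rewrite -!fg ?fD ?fZ ?fM ?f1.
Qed.

Lemma inG_comp f g : inG f -> inG g -> inG (f \o g).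
Proof.
move=> [fA Sf] [gA Sg]; split; first exact: algmor_comp.
by rewrite -tup_comp //; apply: generated_comp.
Qed.

Lemma inG_id : inG id.
Proof. by split; [exact: algmor_id | exact: generated_id]. Qed.

Lemma inG_inv f g : inG f -> algmor g -> cancel f g -> cancel g f -> inG g.
Proof.
move=> [fA Sf] gA fK gK; split=> //.
exact: generated_inv Sf (tup_inverse fA gA fK gK).
Qed.

Lemma Aff_tup (f g : A -> A) : algmor f -> algmor g -> cancel f g -> cancel g f ->
  (forall i, msize (f 'X_i) <= 2)%N -> Aff (tup f).
Proof.
move=> fA gA fK gK f2; split.
  by exists (tup g); apply: tup_inverse.
move=> i; rewrite tnth_mktuple; apply/eqP; rewrite eqn_leq f2 ltnNge.
(* Degree zero is excluded: g would send the constant f(x_i) to a constant instead of x_i. *)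
apply/negP=> /msize1_polyC fi.
by have := msizeXU i; rewrite -(fK 'X_i) fi (algmorC gA) msizeC; case: eqP.
Qed.

Lemma inG_aff f g : algmor f -> algmor g -> cancel f g -> cancel g f ->
  (forall i, msize (f 'X_i) <= 2)%N -> inG f.
Proof.
move=> fA gA fK gK f2; split=> //.
by apply/generated_mem/affS/(Aff_tup fA gA).
Qed.

Lemma inG_conj f g h : inG f -> algmor g -> cancel f g -> cancel g f ->
  inG h -> inG (f \o h \o g).
Proof.
move=> Gf gA fK gK Gh; apply: inG_comp; last exact: inG_inv Gf gA fK gK.
exact: inG_comp.
Qed.

(** In characteristic zero the vanishing derivative means that P does not involve x_i; in this form
    the condition carries over along intertwining maps. *)
Definition inV i P := P^`M(i) = 0 /\ inG (shear i P).

Lemma inV_aff i P : P^`M(i) = 0 -> (msize P <= 2)%N -> inV i P.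
Proof.
move=> fP P2; split=> //.
apply: (inG_aff (algmor_shear charK0 i P) (algmor_shear charK0 i (- P))).
- exact: shearK.
- exact: shearNK.
move=> j; rewrite shearX; apply: msizeD_max; first by rewrite msizeXU.
by case: eqP => // _; rewrite msize0.
Qed.

Lemma inV0 i : inV i 0.
Proof. by apply: inV_aff; rewrite ?mderiv0 ?msize0. Qed.

Lemma inVD i P Q : inV i P -> inV i Q -> inV i (P + Q).
Proof.
move=> [fP GP] [fQ GQ]; split; first by rewrite mderivD fP fQ addr0.
by apply: eq_inG (inG_comp GP GQ) => p /=; rewrite shear_comp.
Qed.

Lemma inG_dilation i c : c != 0 -> inG (dilation i c).
Proof.
move=> c0; apply: (inG_aff (algmor_dilation i c) (algmor_dilation i c^-1)).
- by apply: dilationK; rewrite mulVf.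
- by apply: dilationK; rewrite mulfV.
by move=> j; rewrite dilationX; apply: leq_trans (msizeZ_le _ _) _; rewrite msizeXU.
Qed.

(* Conjugating the shear by a dilation of x_i multiplies P by a constant. *)
Lemma inVZ i c P : inV i P -> inV i (c *: P).
Proof.
have [->|c0] := eqVneq c 0; first by rewrite scale0r => _; apply: inV0.
move=> [fP GP]; split; first by rewrite mderivZ fP scaler0.
have dA d := algmor_dilation i d.
have cV0 : c^-1 != 0 by rewrite invr_neq0.
have K1 : cancel (dilation i c^-1) (dilation i c) by apply: dilationK; rewrite mulfV.
have K2 : cancel (dilation i c) (dilation i c^-1) by apply: dilationK; rewrite mulVf.
apply: eq_inG (inG_conj (inG_dilation i cV0) (dA c) K1 K2 GP) => p /=.
rewrite (@shear_conj _ _ _ _ i i c) //.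
  by rewrite /dilation (shear_free _ fP).
apply: intertwine_X => //; try exact: mderiv_derivation.
move=> j /=; rewrite mderivXU dilationX mderivZ mderivXU.
case: eqP => /= [_|_]; last by rewrite scale1r (algmor0 (dA _)) scaler0.
by rewrite (algmor1 (dA _)) scalerA divff ?scale1r.
Qed.

Lemma inVN i P : inV i P -> inV i (- P).
Proof. by move=> VP; rewrite -scaleN1r; apply: inVZ. Qed.

Lemma inVB i P Q : inV i P -> inV i Q -> inV i (P - Q).
Proof. by move=> VP VQ; apply: inVD => //; apply: inVN. Qed.

Lemma inV_coef i N (q : nat -> A) :
  (forall m : nat, inV i (\sum_(k < N) m%:R ^+ k *: q k)) ->
  forall k, (k < N)%N -> inV i (q k).
Proof.
apply: (subspace_coef charK0); [exact: inV0 | exact: inVD | exact: inVZ].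
Qed.

Lemma inV_conj i P f g : inG f -> algmor g -> cancel f g -> cancel g f ->
  (forall p, f p^`M(i) = (f p)^`M(i)) -> inV i P -> inV i (f P).
Proof.
move=> Gf gA fK gK fi [fP GP]; split; first by rewrite -fi fP (algmor0 Gf.1).
apply: eq_inG (inG_conj Gf gA fK gK GP) => p /=.
rewrite (@shear_conj _ _ _ _ i i 1) ?scale1r //; first exact: Gf.1.
by move=> q; rewrite scale1r fi.
Qed.

Lemma shear_mderiv i j (P : A) : j != i -> P^`M(i) = 0 ->
  forall p, shear j P p^`M(i) = (shear j P p)^`M(i).
Proof.
move=> ji fP p; rewrite -[RHS]scale1r; move: p.
apply: intertwine_X; [exact: algmor_shear | exact: mderiv_derivation
  | exact: mderiv_derivation | move=> k /=].
rewrite scale1r shearX mderivD mderivXU mderivMn fP mul0rn addr0.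
case: (k == i); first exact: algmor1 (algmor_shear charK0 j P).
exact: algmor0 (algmor_shear charK0 j P).
Qed.

End AffineGenerated.

(** * Monomials of a fixed degree as parameters of shears *)

Section Fullness.

Variables (K : fieldType) (n : nat).
Hypothesis charK0 : [pchar K] =i pred0.
Local Notation A := {mpoly K[n]}.
Variables (S : endo K n -> Prop).
Hypothesis affS : forall theta, Aff theta -> S theta.
Local Notation inV := (inV S).
Local Notation inG := (inG S).

(* Isolate the linear term in m of P under x_j |-> x_j + m l. The inverse of this
   substitution is a parameter Q because l = x_j is allowed. *)
Lemma inV_taylor i j (l : A) (Q : nat -> A) P : j != i -> l^`M(i) = 0 ->
  (msize l <= 2)%N ->
  (forall m : nat, cancel (shear j (m%:R *: l)) (shear j (Q m)) /\
                   cancel (shear j (Q m)) (shear j (m%:R *: l))) ->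
  inV i P -> inV i (l * P^`M(j)).
Proof.
move=> ji li l2 QK VP; have [N /eqP PN] := mderiv_nilpotent j P.
have VT m : inV i (shear j (m%:R *: l) P).
  have [K1 K2] := QK m; apply: (inV_conj _ _ K1 K2) => //.
  - apply: (inG_aff affS _ _ K1 K2) => [||k]; try exact: algmor_shear.
    rewrite shearX; apply: msizeD_max; first by rewrite msizeXU.
    case: eqP => _; last by rewrite msize0.
    exact: leq_trans (msizeZ_le _ _) _.
  - exact: algmor_shear.
  - by apply: shear_mderiv => //; rewrite mderivZ li scaler0.
(* The bound is raised to 2 so that the linear coefficient, of index 1, is in range. *)
have := @inV_coef _ _ charK0 _ affS i (maxn N 2)
  (fun k => divD (mderiv j) k P * l ^+ k) _ 1%N.
rewrite leq_max orbT expr1 /divD /= invr1 scale1r mulrC; apply=> // m.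
have := VT m; rewrite /shear (@expDE _ _ _ _ (maxn N 2)); last first.
  by apply: iterD_ge PN _; rewrite leq_maxl.
congr inV; apply: eq_bigr => k _.
by rewrite exprZn -scalerAr.
Qed.

Lemma inV_deriv i j P : j != i -> inV i P -> inV i P^`M(j).
Proof.
move=> ji VP; rewrite -[P^`M(j)]mul1r.
have f1 k (c : K) : (c *: 1 : A)^`M(k) = 0.
  by rewrite mderivZ -mpolyC1 mderivC scaler0.
apply: (@inV_taylor i j 1 (fun m => - (m%:R *: 1))) => // [||m].
- by rewrite -mpolyC1 mderivC.
- by rewrite msize1.
- by split; [exact: shearK | exact: shearNK].
Qed.

Lemma inV_Xderiv i j k P : j != i -> k != i -> inV i P ->
  inV i ('X_k * P^`M(j)).
Proof.
move=> ji ki VP; have [kj|kj] := eqVneq k j; last first.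
  apply: (@inV_taylor i j _ (fun m => - (m%:R *: 'X_k))) => //.
  - by rewrite free_X.
  - by rewrite msizeXU.
  - by move=> m; split; [apply: shearK | apply: shearNK] => //;
      rewrite mderivZ free_X ?scaler0.
rewrite {}kj in ki *.
(* For k = j the substitution scales x_j by 1 + m, which is invertible in characteristic zero. *)
have m1 m : (1 + m%:R : K) != 0 by rewrite -(natrD _ 1) natr_neq0.
apply: (@inV_taylor i j _ (fun m => ((1 + m%:R)^-1 - 1) *: 'X_j)) => //.
- by rewrite free_X.
- by rewrite msizeXU.
move=> m; have -> : m%:R *: 'X_j = (1 + m%:R - 1) *: 'X_j :> A.
  by congr (_ *: _); ring.
by split; apply: dilationK; rewrite ?mulVf ?mulfV.
Qed.

Lemma inV_swap i a P : inV i P ->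
  inV a (subst (fun j => 'X_(tperm i a j)) P).
Proof.
set s := subst _ => -[fP GP].
have sA : algmor s := algmor_subst _.
have sX j : s 'X_j = 'X_(tperm i a j) by rewrite /s substX.
have sK : cancel s s by apply: algmor_cancel => // j; rewrite !sX tpermK.
have sD p : s p^`M(i) = 1 *: (s p)^`M(a).
  move: p; apply: intertwine_X => //; try exact: mderiv_derivation.
  move=> j /=; rewrite scale1r sX !mderivXU.
  rewrite (can2_eq (tpermK i a) (tpermK i a)) tpermR.
  by case: eqP => _; rewrite ?(algmor1 sA) ?(algmor0 sA).
split; first by have := sD P; rewrite fP (algmor0 sA) scale1r.
have Gs : inG s by apply: (inG_aff affS sA sA sK sK) => j; rewrite sX msizeXU.
apply: eq_inG (inG_conj Gs sA sK sK GP) => p /=.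
by rewrite (shear_conj _ sA sK sD) scale1r.
Qed.

Lemma mpolyXM i m : 'X_i * 'X_[m] = 'X_[U_(i) + m] :> A.
Proof. by rewrite mpolyXD. Qed.

(** The operator x_k d/dx_j trades a factor x_j for x_k, up to the exponent of x_j, which is
    invertible. *)
Lemma inV_move i j k (m : 'X_{1..n}) : j != i -> k != i -> m j != 0%N ->
  inV i 'X_[m] -> inV i 'X_[U_(k) + (m - U_(j))].
Proof.
move=> ji ki mj Vm; have := inV_Xderiv ji ki Vm.
rewrite mderivX -scalerAr mpolyXM => /(inVZ charK0 affS (m j)%:R^-1).
by rewrite scalerA mulVf ?scale1r // natr_neq0.
Qed.

(** Induction on the total excess of m over m'. As the degrees agree, an excess at j forces a
    deficit at some k, and [inV_move] trades x_j for x_k. *)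
Lemma inV_monomials i (m : 'X_{1..n}) : m i = 0%N -> inV i 'X_[m] ->
  forall m' : 'X_{1..n}, m' i = 0%N -> mdeg m' = mdeg m -> inV i 'X_[m'].
Proof.
move=> mi Vm m' mi'; have [N] := ubnP (\sum_j (m j - m' j)).
elim: N m mi Vm => // N IH m mi Vm; rewrite ltnS => leN dm.
have [|] := boolP [forall j, m j <= m' j]%N.
  move=> /forallP le; suff -> : m' = m by [].
  have d0 : mdeg (m' - m)%MM = 0%N.
    apply: (@addIn (mdeg m)); rewrite -mdegD submK ?dm //.
    exact/mnm_lepP.
  apply/mnmP => j; apply/eqP; rewrite eqn_leq le andbT.
  by move/eqP: d0; rewrite mdeg_eq0 => /eqP/mnmP/(_ j); rewrite mnmBE mnm0E => /eqP.
rewrite negb_forall => /existsP[j]; rewrite -ltnNge => ltj.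
have /existsP[k ltk] : [exists k, m k < m' k]%N.
  rewrite -[[exists _, _]]negbK negb_exists; apply/negP => /forallP le.
  have : (mdeg m' < mdeg m)%N.
    rewrite !mdegE (bigD1 j) //= [X in (_ < X)%N](bigD1 j) //= -addSn leq_add //.
    by apply: leq_sum => l _; rewrite leqNgt.
  by rewrite dm ltnn.
have ji : j != i by apply: contraTneq ltj => ->; rewrite mi.
have ki : k != i by apply: contraTneq ltk => ->; rewrite mi'.
have kj : k != j by apply: contraTneq ltk => ->; rewrite -leqNgt ltnW.
have mj : m j != 0%N by rewrite -lt0n (leq_ltn_trans _ ltj).
apply: (IH (U_(k) + (m - U_(j)))%MM).
- by rewrite mnmDE mnmBE !mnm1E (negPf ji) (negPf ki) mi.
- exact: inV_move.
- apply: leq_trans leN; rewrite (bigD1 j) //= [X in (_ < X)%N](bigD1 j) //=.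
  rewrite mnmDE mnmBE !mnm1E eqxx (negPf kj) add0n -addSn leq_add //.
    by rewrite subn1; lia.
  apply: leq_sum => l lj; rewrite mnmDE mnmBE !mnm1E [j == l]eq_sym (negPf lj) subn0.
  by case: eqP => [<-|_] //=; lia.
- rewrite dm mdegD mdeg1 -{1}(@submK _ U_(j)%MM m) ?lep1mP //.
  by rewrite mdegD mdeg1 addnC.
Qed.

End Fullness.

(** * From one shear of degree greater than one to all shears *)

Section NonAffineShear.

Variables (K : fieldType) (n : nat).
Hypothesis charK0 : [pchar K] =i pred0.
Local Notation A := {mpoly K[n]}.
Variables (S : endo K n -> Prop).
Hypothesis affS : forall theta, Aff theta -> S theta.
Local Notation inV := (inV S).
Local Notation inG := (inG S).

Lemma mnm_neq0 (m : 'X_{1..n}) : mdeg m != 0%N -> exists j, m j != 0%N.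
Proof.
move=> m0; apply/existsP; rewrite -[[exists _, _]]negbK negb_exists.
apply: contraNN m0 => /forallP m0; rewrite mdeg_eq0; apply/eqP/mnmP => j.
by rewrite mnm0E; apply/eqP; rewrite -[_ == _]negbK m0.
Qed.

Lemma mdegB1 (m : 'X_{1..n}) j : m j != 0%N -> mdeg m = (mdeg (m - U_(j))).+1.
Proof.
by move=> mj; rewrite -{1}(@submK _ U_(j)%MM m) ?lep1mP // mdegD mdeg1 addn1.
Qed.

Lemma mcoeff_mderiv_neq0 (P : A) (m : 'X_{1..n}) j : m \in msupp P -> m j != 0%N ->
  (P^`M(j))@_(m - U_(j)) != 0.
Proof.
move=> mP mj; rewrite mcoeff_mderiv submK ?lep1mP // -mulr_natr.
by rewrite mulf_neq0 -?mcoeff_msupp // natr_neq0.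
Qed.

(** Differentiation along a variable of the leading monomial lowers the degree by exactly one, since
    the characteristic is zero. *)
Lemma inV_degree2 i (P : A) : inV i P -> (2 < msize P)%N ->
  exists2 Q, inV i Q & msize Q = 3.
Proof.
have [N] := ubnP (msize P); elim: N P => // N IH P; rewrite ltnS => leN VP.
rewrite leq_eqVlt => /predU1P[P3|P3]; first by exists P.
have P0 : P != 0 by rewrite -(mmeasure_poly_eq0 mdeg) -lt0n (leq_trans _ P3).
have lP := mlead_supp P0; have dP := mlead_deg P0; set m := mlead P in lP dP.
have /mnm_neq0[j mj] : mdeg m != 0%N by rewrite -lt0n -ltnS dP (leq_trans _ P3).
have ji : j != i by apply: contraNneq mj => ->; rewrite (free_supp charK0 VP.1).
apply: (IH P^`M(j)); last 1 first.
- have := mcoeff_mderiv_neq0 lP mj; rewrite -mcoeff_msupp => /msize_mdeg_lt.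
  by apply: leq_trans; rewrite -ltnS -(mdegB1 mj) -ltnS dP.
- apply: leq_ltn_trans (msize_mderiv _ _) _.
  by rewrite prednK // (leq_trans _ P3).
- exact: inV_deriv.
Qed.

(* If x_a x_b occurs in the quadratic polynomial Q and R = x_b (dQ/dx_a), then
   x_b (dR/dx_b) - R is a nonzero multiple of x_b^2. *)
Lemma inV_square i (Q : A) : inV i Q -> msize Q = 3 ->
  exists2 b, b != i & inV i 'X_[U_(b) *+ 2].
Proof.
move=> VQ Q3; have Q0 : Q != 0 by rewrite -(mmeasure_poly_eq0 mdeg) Q3.
have lQ := mlead_supp Q0; have [] := mlead_deg Q0.
set m := mlead Q in lQ *; rewrite Q3 => -[dm].
have /mnm_neq0[a ma] : mdeg m != 0%N by rewrite dm.
have dma : mdeg (m - U_(a)) = 1%N by apply: succn_inj; rewrite -(mdegB1 ma).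
have /mdeg1P[b /eqP mab] : mdeg (m - U_(a)) == 1%N by rewrite dma.
have mi : m i = 0%N by exact: (free_supp charK0 VQ.1).
have ai : a != i by apply: contraNneq ma => ->; rewrite mi.
have bi : b != i.
  apply/negP=> /eqP bi; have := congr1 (fun m : 'X_{1..n} => m b) mab.
  by rewrite /= mnmBE !mnm1E eqxx bi mi sub0n.
exists b => //; pose R := 'X_b * Q^`M(a).
have VR : inV i R by apply: inV_Xderiv.
have VT : inV i ('X_b * R^`M(b) - R) by apply: inVB => //; apply: inV_Xderiv.
have RE m' : R@_m' != 0 -> m' b != 0%N /\ (mdeg m' <= 2)%N.
  rewrite mcoeff_XM; have [_|m'b] := eqVneq (m' b) 0%N; first by rewrite /= eqxx.
  rewrite mcoeff_mderiv => h; split=> //; rewrite (mdegB1 m'b).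
  have : (m' - U_(b) + U_(a))%MM \in msupp Q.
    by rewrite mcoeff_msupp; apply: contraNneq h => ->; rewrite mul0rn.
  by move/msize_mdeg_lt; rewrite Q3 mdegD mdeg1 addn1.
(* This Euler-type operator multiplies each monomial by its exponent at x_b minus one, so it kills
   the terms linear in x_b. *)
have TE m' : ('X_b * R^`M(b) - R)@_m' = ((m' b)%:R - 1) * R@_m'.
  rewrite mcoeffB mcoeff_XM; have [m'b|m'b] := eqVneq (m' b) 0%N.
    by rewrite m'b !sub0r mulN1r.
  rewrite mcoeff_mderiv submK ?lep1mP // mnmBE mnm1E eqxx.
  by rewrite subn1 prednK ?lt0n // mulrBl mul1r mulr_natl.
have Rb2 : R@_(U_(b) *+ 2) != 0.
  rewrite mcoeff_XM mulmnE mnm1E eqxx /= mulmS mulm1n addmK -mab.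
  exact: mcoeff_mderiv_neq0.
have TX : 'X_b * R^`M(b) - R = R@_(U_(b) *+ 2) *: 'X_[U_(b) *+ 2].
  apply/mpolyP => m'; rewrite TE mcoeffZ mcoeffX.
  have [<-|m'2] := eqVneq (U_(b) *+ 2)%MM m'.
    by rewrite mulmnE mnm1E eqxx mul1n mulr1 (natrD _ 1 1) addrK mul1r.
  rewrite mulr0; have [->|Rm'] := eqVneq R@_m' 0; first by rewrite mulr0.
  have [m'b dm'] := RE _ Rm'.
  suff -> : m' b = 1%N by rewrite subrr mul0r.
  apply/eqP; rewrite eqn_leq lt0n m'b andbT leqNgt; apply: contraNN m'2 => m'b2.
  have le2 : (U_(b) *+ 2 <= m')%MM.
    by apply/mnm_lepP => j; rewrite mulmnE mnm1E; case: eqP => // <-.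
  rewrite -(submK le2); suff /eqP -> : (m' - U_(b) *+ 2)%MM == 0%MM by rewrite add0m.
  rewrite -mdeg_eq0 -leqn0 -(leq_add2r (mdeg (U_(b) *+ 2)%MM)) -mdegD submK //.
  by rewrite mdegMn mdeg1.
by have := inVZ charK0 affS (R@_(U_(b) *+ 2))^-1 VT; rewrite TX scalerA mulVf ?scale1r.
Qed.

Hypothesis n_ge3 : (3 <= n)%N.

Lemma exists_distinct (i : 'I_n) : exists a k, [/\ a != i, k != i & k != a].
Proof.
have [a ai] : exists a, a \in predC1 i.
  by apply/card_gt0P; rewrite cardC1 card_ord; lia.
have [k] : exists k, k \in [predD1 predC1 i & a].
  apply/card_gt0P; have := cardD1 a (predC1 i).
  rewrite cardC1 card_ord ai -(ltn_add2l 1) => /= E.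
  by rewrite -[X in (_ < X)%N]E; lia.
by rewrite !inE => /andP[ka ki]; exists a, k.
Qed.

Definition full_degree d :=
  forall i (m : 'X_{1..n}), m i = 0%N -> mdeg m = d -> inV i 'X_[m].

(** To pass from the direction i to a, take a power of a third variable x_k: the transposition of
    x_i and x_a fixes it. Within one direction [inV_monomials] applies. *)
Lemma inV_full_degree d i (m : 'X_{1..n}) : mdeg m = d -> m i = 0%N ->
  inV i 'X_[m] -> full_degree d.
Proof.
move=> dm mi Vm.
have Vi (m' : 'X_{1..n}) : m' i = 0%N -> mdeg m' = d -> inV i 'X_[m'].
  by move=> mi' dm'; apply: (inV_monomials charK0 affS mi Vm); rewrite ?dm ?mi'.
move=> a m' ma' dm'; have [ia|ia] := eqVneq i a.
  by rewrite -ia in ma' *; apply: Vi.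
have [k [ka ki]] : exists k, k != a /\ k != i.
  have [b [k [bi ki kb]]] := exists_distinct i.
  have [ba|ba] := eqVneq b a; last by exists b.
  by exists k; rewrite -ba.
have pow_k j : k != j -> (U_(k) *+ d)%MM j = 0%N.
  by move=> kj; rewrite mulmnE mnm1E (negPf kj).
have := inV_swap affS a (Vi (U_(k) *+ d)%MM (pow_k _ ki) _).
have -> : subst (fun j => 'X_(tperm i a j)) 'X_[U_(k) *+ d] = 'X_[U_(k) *+ d] :> A.
  rewrite -mpolyXn (algmorXn (algmor_subst _)) substX tpermD //.
    by rewrite eq_sym.
  by rewrite eq_sym.
rewrite mdegMn mdeg1 mul1n => /(_ erefl) Vk.
by apply: (inV_monomials charK0 affS _ Vk) => //; rewrite ?pow_k // mdegMn mdeg1 mul1n.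
Qed.

(* Conjugating x_i |-> x_i + x_k x_a by x_a |-> x_a + x_k^d raises the degree. *)
Lemma full_degreeS d : full_degree 2 -> full_degree d -> full_degree d.+1.
Proof.
move=> full2 fulld i.
have [a [k [ai ki ka]]] := exists_distinct i.
have pow_k e j : k != j -> (U_(k) *+ e)%MM j = 0%N.
  by move=> kj; rewrite mulmnE mnm1E (negPf kj).
have [fk Gk] : inV a 'X_[U_(k) *+ d].
  by apply: fulld; rewrite ?pow_k // mdegMn mdeg1 mul1n.
have Vka : inV i ('X_k * 'X_a).
  rewrite mpolyXM; apply: full2; last by rewrite mdegD !mdeg1.
  by rewrite mnmDE !mnm1E (negPf ki) (negPf ai).
have fi : ('X_[U_(k) *+ d] : A)^`M(i) = 0 by rewrite mderivX pow_k ?scale0r.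
have := inV_conj Gk (algmor_shear charK0 _ _) (shearK charK0 fk)
  (shearNK charK0 fk) (shear_mderiv charK0 ai fi) Vka.
rewrite (algmorM (algmor_shear charK0 _ _)) shearX_neq // shearX_eq // mulrDr.
move=> /(inVB charK0 affS)/(_ Vka); rewrite addrC addKr mpolyXM -mulmS => Vk.
apply: (inV_full_degree _ _ Vk); rewrite ?pow_k //.
by rewrite mdegMn mdeg1 mul1n.
Qed.

Definition full := forall i P, P^`M(i) = 0 -> inG (shear i P).

Lemma inV_nonaffine_full i P : inV i P -> (2 < msize P)%N -> full.
Proof.
move=> VP /(inV_degree2 VP)[Q VQ Q3]; have [b bi Vb] := inV_square VQ Q3.
have full2 : full_degree 2.
  by apply: (inV_full_degree _ _ Vb); rewrite ?mdegMn ?mdeg1 ?mulmnE ?mnm1E ?(negPf bi).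
have fulld d : full_degree d.+2 by elim: d => // d; apply: full_degreeS.
move=> {VP VQ Vb bi} j {}P fP; suff [] : inV j P by [].
rewrite [P]mpolyE big_seq; elim/big_rec: _ => [|m p mP Vp]; first exact: inV0.
apply: inVD => //; apply: inVZ => //.
have mj : m j = 0%N by apply: free_supp fP mP.
have [dm|dm] := leqP (mdeg m) 1.
  by apply: inV_aff => //; rewrite ?msizeX // mderivX mj scale0r.
by apply: (fulld (mdeg m).-2) => //; case: (mdeg m) dm => [|[]].
Qed.

End NonAffineShear.

(** * All shears together with the affine automorphisms generate the tame ones *)

Section TameGeneration.

Variables (K : fieldType) (n : nat).
Hypothesis charK0 : [pchar K] =i pred0.
Local Notation A := {mpoly K[n]}.
Variables (S : endo K n -> Prop).
Hypothesis affS : forall theta, Aff theta -> S theta.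
Local Notation inV := (inV S).
Local Notation inG := (inG S).

Lemma in_first_vars_free i (j : 'I_n) (p : A) : in_first_vars i p -> (i <= j)%N ->
  p^`M(j) = 0.
Proof.
move=> pi leij; apply/mpolyP => m; rewrite mcoeff_mderiv mcoeff0.
suff -> : p@_(m + U_(j)) = 0 by rewrite mul0rn.
apply/eqP; rewrite mcoeff_eq0; apply/negP => /pi /(_ j leij) /eqP.
by rewrite mnmDE mnm1E eqxx addn1.
Qed.

(** Built one variable at a time: [f k] agrees with psi on the first k variables and [f k.+1] is
    [e \o f k], where [e] moves x_k alone and so fixes the images of the earlier variables. *)
Lemma full_BA psi : full S -> BA psi -> generated S psi.
Proof.
move=> fullS [u [P uP]].
pose f k := subst (fun j : 'I_n => if (j < k)%N then u j *: 'X_j + P j else 'X_j).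
have fX k j : f k 'X_j = if (j < k)%N then u j *: 'X_j + P j else 'X_j.
  by rewrite /f substX.
suff inGf k : inG (f k).
  have -> : psi = tup (f n); last exact: (inGf n).2.
  apply: eq_from_tnth => i; rewrite tnth_mktuple fX ltn_ord.
  by have [] := uP i.
elim: k => [|k IH].
  apply: eq_inG (inG_id S); apply: algmor_ext; first exact: algmor_id.
    exact: algmor_subst.
  by move=> i; rewrite fX ltn0.
have [ltkn|lenk] := ltnP k n; last first.
  apply: eq_inG IH; apply: algmor_ext; try exact: algmor_subst.
  move=> i; rewrite !fX !ifT // (leq_trans (ltn_ord i)) // ltnW //.
pose k' := Ordinal ltkn.
have [u0 Pk _] := uP k'; have freeP : (P k')^`M(k') = 0.
  exact: in_first_vars_free Pk _.
(* The shear acts after the dilation, so its parameter gets multiplied by [u k']. *)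
pose e := shear k' ((u k')^-1 *: P k') \o dilation k' (u k').
have Ge : inG e.
  apply: inG_comp; last exact: inG_dilation.
  by apply: fullS; rewrite mderivZ freeP scaler0.
have eX : e 'X_k' = u k' *: 'X_k' + P k'.
  rewrite /e /= dilationX // eqxx (algmorZ (algmor_shear _ _ _)) //.
  by rewrite shearX_eq // scalerDr scalerA divff ?scale1r.
have e_free p : p^`M(k') = 0 -> e p = p.
  by move=> fp; rewrite /e /= /dilation !shear_free.
apply: eq_inG (inG_comp Ge IH); apply: algmor_ext.
- exact: (inG_comp Ge IH).1.
- exact: algmor_subst.
move=> j; rewrite /= !fX ltnS (leq_eqVlt j k).
have [jk|jk] := eqVneq (j : nat) k.
  have -> : j = k' by apply: val_inj.
  by rewrite /= ltnn eX.
have jk' : j != k' by apply: contraNneq jk => ->.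
rewrite /=; case: ifP => ltjk; last by rewrite e_free // free_X.
rewrite e_free // mderivD mderivZ free_X // scaler0 add0r.
have [_ Pj _] := uP j; apply: (in_first_vars_free Pj); exact: ltnW.
Qed.

Lemma full_TA psi : full S -> TA psi -> generated S psi.
Proof.
move=> fullS; elim=> [theta [Atheta|Btheta]||f g _ Sf _ Sg|f g _ Sf fg].
- exact/generated_mem/affS.
- exact: full_BA.
- exact: generated_id.
- exact: generated_comp.
- exact: generated_inv Sf fg.
Qed.

End TameGeneration.

(** * The exponentials exp(HD), with H in ker D, that lie in the group *)

Section Replicas.

Variables (K : fieldType) (n : nat).
Hypothesis charK0 : [pchar K] =i pred0.
Hypothesis n_ge3 : (3 <= n)%N.
Local Notation A := {mpoly K[n]}.
Variables (S : endo K n -> Prop).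
Hypothesis affS : forall theta, Aff theta -> S theta.
Local Notation inV := (inV S).
Local Notation inG := (inG S).

Variables (D : {linear A -> A}) (nilD : locally_nilpotent D).
Hypothesis derD : derivation D.

Definition inW H := D H = 0 /\ inG (expD nilD H).

Lemma inW0 : inW 0.
Proof.
split; first by rewrite linear0.
by apply: eq_inG (inG_id S) => p; rewrite expD0.
Qed.

Lemma inWD F H : inW F -> inW H -> inW (F + H).
Proof.
move=> [DF GF] [DH GH]; split; first by rewrite linearD /= DF DH addr0.
by apply: eq_inG (inG_comp GF GH) => p /=; rewrite expD_comp.
Qed.

Lemma inWN H : inW H -> inW (- H).
Proof.
move=> [DH GH]; split; first by rewrite linearN /= DH oppr0.
by apply: inG_inv GH _ _ _; [apply: algmor_expD | apply: expDK | apply: expDNK].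
Qed.

Lemma inWB F H : inW F -> inW H -> inW (F - H).
Proof. by move=> WF WH; apply: inWD => //; apply: inWN. Qed.

Lemma inWMn H k : inW H -> inW (k%:R *: H).
Proof.
move=> WH; rewrite scaler_nat.
by elim: k => [|k IH]; [exact: inW0 | rewrite mulrS; exact: inWD].
Qed.

Lemma inW_conj f g c H : inG f -> algmor g -> cancel f g -> cancel g f ->
  (forall p, f (D p) = c *: D (f p)) -> inW H -> inW (c *: f H).
Proof.
move=> Gf gA fK gK fD [DH GH]; split.
  by rewrite linearZ /= -fD DH (algmor0 Gf.1).
apply: eq_inG (inG_conj Gf gA fK gK GH) => p /=.
by rewrite (expD_intertwine nilD nilD _ _ Gf.1 fD) gK.
Qed.

Variable z : 'I_n.
Hypothesis freeD : forall i, (D 'X_i)^`M(z) = 0.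

(** On the variables both sides vanish, because d/dx_z sends them to constants. *)
Lemma freeD_comm p : (D p)^`M(z) = D p^`M(z).
Proof.
apply: (derivation_comm (mderiv_derivation z) derD) => i /=.
rewrite freeD mderivXU; case: eqP => _; last by rewrite linear0.
by rewrite -mpolyC1 derivationC.
Qed.

Lemma inV_expD H P : inW H -> H^`M(z) = 0 -> inV z P -> inV z (expD nilD H P).
Proof.
move=> [DH GH] Hz; apply: inV_conj GH (algmor_expD charK0 nilD derD (- H)) _ _ _ => //.
- exact: expDK.
- exact: expDNK.
move=> p; rewrite (expD_derivation charK0 _ _ (mderiv_derivation z)) //.
exact: freeD_comm.
Qed.

(** Conjugation by exp(m f D) turns the parameter x_j into a polynomial in m with linear coefficient
    f D(x_j). *)
Lemma inV_FD f j : inW f -> f^`M(z) = 0 -> j != z -> inV z (f * D 'X_j).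
Proof.
move=> Wf fz jz; have [N /eqP DN] := nilD 'X_j.
have := @inV_coef _ _ charK0 _ affS z (maxn N 2)
  (fun k => divD D k 'X_j * f ^+ k) _ 1%N.
rewrite leq_max orbT expr1 /divD /= invr1 scale1r mulrC; apply=> // m.
have Vj : inV z 'X_j by apply: inV_aff; rewrite ?free_X ?msizeXU.
have := inV_expD (inWMn m Wf) _ Vj; rewrite mderivZ fz scaler0 => /(_ erefl).
rewrite (@expDE _ _ _ _ (maxn N 2)); last by apply: iterD_ge DN _; rewrite leq_maxl.
congr inV; apply: eq_bigr => k _.
by rewrite exprZn -scalerAr.
Qed.

Section AffineClosure.

Variables (f : A) (C : pred 'I_n).
Hypothesis Df0 : D f = 0.
Hypothesis affC : forall j, C j -> (msize (f * D 'X_j) <= 2)%N.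
Hypothesis freeC : forall j, ~~ C j -> f^`M(j) = 0 /\ forall p, (D p)^`M(j) = D p^`M(j).

(** Makes the affine forms in the variables of C stable under fD. Here C consists of all variables
    but x_z in [inV_FDz], and of all variables in [Aff_expD]. *)
Lemma affine_FD p : (msize p <= 2)%N -> (forall j, ~~ C j -> p^`M(j) = 0) ->
  (msize (f * D p) <= 2)%N /\ forall j, ~~ C j -> (f * D p)^`M(j) = 0.
Proof.
move=> p2 pC; split; last first.
  move=> j /[dup] /pC pj /freeC[fj Dj].
  by rewrite mderivM fj mul0r add0r Dj pj linear0 mulr0.
rewrite [p]mpolyE linear_sum big_distrr /= big_seq.
elim/big_rec: _ => [|m q mp q2]; first by rewrite msize0.
apply: msizeD_max => //; rewrite linearZ /= -scalerAr.
apply: leq_trans (msizeZ_le _ _) _.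
have := leq_trans (msize_mdeg_lt mp) p2; rewrite ltnS leq_eqVlt ltnS leqn0.
move=> /orP[/mdeg1P[j /eqP mj]|]; last first.
  rewrite mdeg_eq0 => /eqP ->; rewrite mpolyX0 -mpolyC1 derivationC //.
  by rewrite mulr0 msize0.
rewrite mj; apply: affC; apply/negPn/negP=> /pC pj.
by have := free_supp charK0 pj mp; rewrite mj mnm1E eqxx.
Qed.

Lemma affine_expD c j : C j -> (msize (expD nilD (c *: f) 'X_j) <= 2)%N.
Proof.
move=> Cj; have [N /eqP DN] := nilD 'X_j; rewrite (expDE _ _ DN).
elim/big_rec: _ => [|k q _ q2]; first by rewrite msize0.
apply: msizeD_max => //; rewrite exprZn -scalerAr /divD -scalerAl.
do 2![apply: leq_trans (msizeZ_le _ _) _].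
suff [] : (msize (iter k D 'X_j * f ^+ k) <= 2)%N /\
    forall i, ~~ C i -> (iter k D 'X_j * f ^+ k)^`M(i) = 0 by [].
elim: (k : nat) => [|l [IH2 IHC]].
  rewrite expr0 mulr1 msizeXU; split=> // i Ci; rewrite free_X //.
  by apply: contraNneq Ci => <-.
suff -> : iter l.+1 D 'X_j * f ^+ l.+1 = f * D (iter l D 'X_j * f ^+ l).
  exact: affine_FD.
rewrite derD (derivationX0 l derD Df0) mulr0 addr0 exprS -iterS.
by rewrite mulrCA.
Qed.

End AffineClosure.

(** The shear with parameter -x_z puts x_z := 0 and fixes p; after composition with it, the values
    of g and h at x_z no longer matter. *)
Lemma algmor_eq_free (g h : A -> A) p : algmor g -> algmor h ->
  (forall j, j != z -> g 'X_j = h 'X_j) -> p^`M(z) = 0 -> g p = h p.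
Proof.
move=> gA hA gh pz; have sA := algmor_shear charK0 z (- 'X_z : A).
rewrite -(shear_free (- 'X_z) pz); move: p {pz}.
apply: algmor_ext (algmor_comp gA sA) (algmor_comp hA sA) _ => j /=.
have [->|jz] := eqVneq j z; last by rewrite shearX_neq // gh.
by rewrite shearX_eq // subrr (algmor0 gA) (algmor0 hA).
Qed.

Lemma expD_free H p : H^`M(z) = 0 -> p^`M(z) = 0 -> (expD nilD H p)^`M(z) = 0.
Proof.
move=> Hz pz; rewrite (expD_derivation charK0 nilD p (mderiv_derivation z)) //.
  by rewrite /= pz (algmor0 (algmor_expD charK0 _ derD _)).
exact: freeD_comm.
Qed.

(* Dividing exp(m f D) by its restriction to the variables other than x_z
   leaves a shear in the direction of x_z. *)
Lemma inV_FDz f : inW f -> f^`M(z) = 0 ->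
  (forall j, j != z -> (msize (f * D 'X_j) <= 2)%N) -> inV z (f * D 'X_z).
Proof.
move=> Wf fz affz; have Df0 := Wf.1.
have cfz (c : K) : (c *: f)^`M(z) = 0 by rewrite mderivZ fz scaler0.
have Dcf (c : K) : D (c *: f) = 0 by rewrite linearZ /= Df0 scaler0.
have EA (c : K) : algmor (expD nilD (c *: f)) by apply: algmor_expD.
have EK (c : K) : cancel (expD nilD (c *: f)) (expD nilD (- c *: f)).
  by rewrite scaleNr; apply: expDK.
have freeC j : ~~ predC1 z j -> f^`M(j) = 0 /\ forall p, (D p)^`M(j) = D p^`M(j).
  by move=> /negPn/eqP ->; split=> // p; apply: freeD_comm.
pose B (c : K) := subst (fun j => if j == z then 'X_z else expD nilD (c *: f) 'X_j).
have BA c : algmor (B c) by apply: algmor_subst.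
have BX c j : j != z -> B c 'X_j = expD nilD (c *: f) 'X_j.
  by move=> /negPf jz; rewrite /B substX jz.
have Bz c : B c 'X_z = 'X_z by rewrite /B substX eqxx.
have BE c p : p^`M(z) = 0 -> B c p = expD nilD (c *: f) p.
  by apply: algmor_eq_free => // j; apply: BX.
have EXfree c j : j != z -> (expD nilD (c *: f) 'X_j)^`M(z) = 0.
  by move=> jz; apply: expD_free => //; rewrite free_X.
have BK c : cancel (B c) (B (- c)).
  apply: algmor_cancel => // j; have [->|jz] := eqVneq j z; first by rewrite !Bz.
  by rewrite BX // BE ?EXfree // EK.
have BNK c : cancel (B (- c)) (B c) by rewrite -{2}[c]opprK; apply: BK.
have GB c : inG (B c).
  apply: (inG_aff affS (BA c) (BA (- c)) (BK c) (BNK c)) => j.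
  have [->|jz] := eqVneq j z; first by rewrite Bz msizeXU.
  by rewrite BX //; apply: (affine_expD Df0 affz freeC).
have VE (m : nat) : inV z (expD nilD (m%:R *: f) 'X_z - 'X_z).
  have [_ Gm] := inWMn m Wf; split.
    rewrite mderivB.
    rewrite (expD_derivation charK0 nilD _ (mderiv_derivation z) freeD_comm (cfz _)) /=.
    by rewrite mderivXU eqxx (algmor1 (EA _)) subrr.
  apply: eq_inG (inG_comp Gm (GB (- m%:R))).
  apply: algmor_ext; [exact: algmor_comp | exact: algmor_shear | move=> j /=].
  have [->|jz] := eqVneq j z; first by rewrite Bz shearX_eq // addrC subrK.
  by rewrite BX // shearX_neq // -{1}[m%:R]opprK EK.
have [N /eqP DN] := nilD 'X_z.
(* The constant coefficient is 0 because [VE] subtracts x_z; the bound keeps the indices 0 and 1 in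
   range. *)
have := @inV_coef _ _ charK0 _ affS z N.+2
  (fun k => if k == 0%N then 0 else divD D k 'X_z * f ^+ k) _ 1%N.
rewrite /= expr1 /divD /= invr1 scale1r mulrC; apply=> // m.
have := VE m; rewrite (@expDE _ _ _ _ N.+2); last first.
  by apply: iterD_ge DN _; rewrite leqW.
rewrite !big_ord_recl /= divD0 expr0 mulr1 scaler0 add0r addrAC subrr add0r.
congr inV; rewrite exprZn -scalerAr; congr (_ + _); apply: eq_bigr => k _.
by rewrite exprZn -scalerAr.
Qed.

(** The variable x_z is treated last, since [inV_FDz] presupposes that f D(x_j) is affine for the
    other j. *)
Lemma affine_or_full f : inW f -> f^`M(z) = 0 ->
  full S \/ forall i, (msize (f * D 'X_i) <= 2)%N.
Proof.
move=> Wf fz.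
have [/forallP|] := boolP [forall i, msize (f * D 'X_i) <= 2]%N; first by right.
rewrite negb_forall => /existsP[i]; rewrite -ltnNge => fDi; left.
have [/forallP affz|] := boolP [forall j, (j != z) ==> (msize (f * D 'X_j) <= 2)]%N.
  have iz : i = z.
    by apply/eqP; apply: contraTT fDi => iz; rewrite -leqNgt (implyP (affz i)).
  apply: inV_nonaffine_full fDi => //; rewrite iz.
  by apply: inV_FDz => // j; apply/implyP.
rewrite negb_forall => /existsP[j]; rewrite negb_imply -ltnNge => /andP[jz fDj].
by apply: inV_nonaffine_full fDj => //; apply: inV_FD.
Qed.

Lemma Aff_expD f : D f = 0 -> (forall i, (msize (f * D 'X_i) <= 2)%N) ->
  Aff (tup (expD nilD f)).
Proof.
move=> Df aff; apply: (@Aff_tup _ _ _ (expD nilD (- f))).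
- exact: algmor_expD.
- exact: algmor_expD.
- exact: expDK.
- exact: expDNK.
move=> i; rewrite -[f]scale1r.
by apply: (@affine_expD f predT) => // j _; apply: aff.
Qed.

End Replicas.

(** * Affine forms, constant D(x_i), and reduction to degree one in x_z *)

Section AffineForms.

Variables (K : fieldType) (n : nat).
Hypothesis charK0 : [pchar K] =i pred0.
Local Notation A := {mpoly K[n]}.

Lemma affineE (p : A) : (msize p <= 2)%N ->
  p = (p@_0)%:MP + \sum_j p@_U_(j) *: 'X_j.
Proof.
move=> p2; apply/mpolyP => m; rewrite mcoeffD mcoeffC raddf_sum /=.
have sumE k : \sum_(j < n) (p@_U_(j) *: 'X_j)@_k =
    \sum_(j < n) p@_U_(j) * (U_(j)%MM == k)%:R.
  by apply: eq_bigr => j _; rewrite mcoeffZ mcoeffX.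
rewrite sumE; have [dm|dm] := leqP 2 (mdeg m).
  have pm : p@_m = 0 by apply/eqP; rewrite mcoeff_eq0 msize_mdeg_ge // (leq_trans p2).
  have -> : (m == 0%MM) = false by rewrite -mdeg_eq0; case: (mdeg m) dm.
  rewrite pm mulr0 add0r big1 // => j _; case: eqP => [jm|_]; last by rewrite mulr0.
  by rewrite -jm mdeg1 in dm.
have [->|m0] := eqVneq m 0%MM.
  by rewrite mulr1 big1 ?addr0 // => j _; rewrite mnm1_eq0 mulr0.
have /mdeg1P[i /eqP ->] : mdeg m == 1%N by rewrite eqn_leq -ltnS dm lt0n mdeg_eq0.
rewrite mulr0 add0r (bigD1 i) //= eqxx mulr1 big1 ?addr0 // => j ji.
by rewrite eq_mnm1 (negPf ji) mulr0.
Qed.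

Lemma affine_mderiv (p : A) j : (msize p <= 2)%N -> p^`M(j) = (p@_U_(j))%:MP.
Proof.
move=> p2; have := leq_trans (msize_mderiv p j) (_ : (msize p).-1 <= 1)%N.
rewrite -subn1 leq_subLR => /(_ p2)/msize1_polyC ->.
by rewrite mcoeff_mderiv add0m mnm0E mulr1n.
Qed.

Lemma msize_affine f (p : A) : algmor f -> (forall j, (msize (f 'X_j) <= 2)%N) ->
  (msize p <= 2)%N -> (msize (f p) <= 2)%N.
Proof.
move=> fA f2 /affineE ->; rewrite (algmorD fA) (algmorC fA).
apply: msizeD_max; first by rewrite msizeC; case: eqP.
rewrite (algmor_sum fA); elim/big_rec: _ => [|j q _ q2]; first by rewrite msize0.
apply: msizeD_max => //; rewrite (algmorZ fA).
exact: leq_trans (msizeZ_le _ _) _.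
Qed.

Variables (S : endo K n -> Prop).
Hypothesis affS : forall theta, Aff theta -> S theta.
Hypothesis n_ge3 : (3 <= n)%N.
Variables (D : {linear A -> A}) (nilD : locally_nilpotent D).
Hypothesis derD : derivation D.
Local Notation inV := (inV S).
Local Notation inG := (inG S).
Local Notation inW := (inW S nilD).

(* In suitable linear coordinates D is a multiple of a partial derivative. *)
Lemma inW_constant_coef (d : 'I_n -> K) F : (forall i, D 'X_i = (d i)%:MP) ->
  inW F -> full S \/ forall i, (msize (F * D 'X_i) <= 2)%N.
Proof.
move=> DX [DF GF]; have [/forallP d0|] := boolP [forall i, d i == 0].
  by right=> i; rewrite DX (eqP (d0 i)) mulr0 msize0.
rewrite negb_forall => /existsP[i di].
(* The coordinate change is [f 1]; the parameter s provides its inverse as [f (- 1)]. *)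
pose f (s : K) := subst (fun j => 'X_j + (s * (if j == i then 0 else d j / d i)) *: 'X_i).
have fA s : algmor (f s) := algmor_subst _.
have fX s j : f s 'X_j = 'X_j + (s * (if j == i then 0 else d j / d i)) *: 'X_i.
  by rewrite /f substX.
have fXi s : f s 'X_i = 'X_i by rewrite fX eqxx mulr0 scale0r addr0.
have fK s : cancel (f s) (f (- s)).
  apply: algmor_cancel => // j; rewrite fX (algmorD (fA _)) (algmorZ (fA _)) fXi fX.
  by rewrite mulNr scaleNr subrK.
have fNK : cancel (f (- 1)) (f 1) by rewrite -{2}[1]opprK; apply: fK.
have f2 s j : (msize (f s 'X_j) <= 2)%N.
  rewrite fX; apply: msizeD_max; first by rewrite msizeXU.
  by apply: leq_trans (msizeZ_le _ _) _; rewrite msizeXU.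
have fD p : f 1 (D p) = d i *: (f 1 p)^`M(i).
  move: p; apply: intertwine_X => //; first exact: mderiv_derivation.
  move=> j /=; rewrite DX (algmorC (fA 1)) fX mderivD mderivZ !mderivXU eqxx mul1r.
  rewrite -mul_mpolyC; case: eqP => [->|_]; rewrite ?scale0r ?addr0 ?mulr1 //.
  by rewrite add0r -[_ *: 1]mul_mpolyC mulr1 -mpolyCM mulrCA divff ?mulr1.
have VF : inV i (d i *: f 1 F).
  split; first by rewrite mderivZ -fD DF (algmor0 (fA 1)).
  have Gf : inG (f 1) by apply: (inG_aff affS (fA 1) (fA (- 1)) (fK 1) fNK).
  apply: eq_inG (inG_conj Gf (fA (-1)) (fK 1) fNK GF) => p /=.
  rewrite (@expD_intertwine _ _ D (mderiv i) nilD (@mderiv_nilpotent K n i) (f 1) (d i)) //.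
  by rewrite fNK.
have [F2|F3] := leqP (msize (d i *: f 1 F)) 2; last first.
  by left; apply: (inV_nonaffine_full _ _ _ VF F3).
right=> j; rewrite DX mulrC mul_mpolyC; apply: leq_trans (msizeZ_le _ _) _.
rewrite -[F](fK 1) -[f 1 F](scalerK di); apply: msize_affine => //.
exact: leq_trans (msizeZ_le _ _) _.
Qed.

Variable z : 'I_n.
Hypothesis freeD : forall i, (D 'X_i)^`M(z) = 0.

Lemma shear_commD h : h^`M(z) = 0 -> D h = 0 ->
  forall p, shear z h (D p) = 1 *: D (shear z h p).
Proof.
move=> hz Dh; apply: intertwine_X => //; first exact: algmor_shear.
move=> j /=; rewrite scale1r shear_free // shearX linearD /=.
by rewrite linearMn /= Dh mul0rn addr0.
Qed.

Lemma inW_shear h F : (msize h <= 2)%N -> h^`M(z) = 0 -> D h = 0 ->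
  inW F -> inW (shear z h F).
Proof.
move=> h2 hz Dh WF; rewrite -[shear z h F]scale1r.
apply: (inW_conj (g := shear z (- h))) WF.
- by have [] := inV_aff charK0 affS hz h2.
- exact: algmor_shear.
- exact: shearK.
- exact: shearNK.
exact: shear_commD.
Qed.

Lemma shear_affine_in_z h (p : A) : (p^`M(z))^`M(z) = 0 ->
  shear z h p = p + p^`M(z) * h.
Proof.
move=> pzz; rewrite /shear (@expDE _ _ _ _ 2) //.
rewrite 2!big_ord_recr big_ord0 /= add0r divD0 expr0 mulr1 expr1.
by rewrite /divD /= invr1 scale1r.
Qed.

(* Differences F(x_z + 1) - F lower the degree in x_z to one. *)
Lemma inW_degree1 F : inW F -> F^`M(z) != 0 ->
  exists F1, [/\ inW F1, F1^`M(z) != 0 & (F1^`M(z))^`M(z) = 0].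
Proof.
move=> WF Fz0; have [] := ex_minnP (mderiv_nilpotent z F).
case=> [|[|k]] /eqP Fk minF.
- by rewrite /= in Fk; rewrite Fk mderiv0 eqxx in Fz0.
- by rewrite /= in Fk; rewrite Fk eqxx in Fz0.
have {}minF : iter k.+1 (mderiv z) F != 0.
  by apply/negP=> /minF; rewrite ltnn.
elim: k F WF Fk minF {Fz0} => [|k IH] F WF Fk minF; first by exists F.
pose t := shear z (1 : A).
have tA : algmor t by apply: algmor_shear.
have one_z : (1 : A)^`M(z) = 0 by rewrite -mpolyC1 mderivC.
have td j : iter j (mderiv z) (t F) = t (iter j (mderiv z) F).
  elim: j => //= j ->; exact: (expD_derivation charK0 _ _ (mderiv_derivation z)).
pose F' := t F - F.
(* The derivative of F of order k + 1 has degree one in x_z, so its difference along the translation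
   is the next derivative. *)
have F'E : iter k.+1 (mderiv z) F' = iter k.+2 (mderiv z) F.
  have dB j p q : iter j (mderiv z) (p - q) = iter j (mderiv z) p - iter j (mderiv z) q.
    by elim: j => //= j ->; rewrite mderivB.
  rewrite dB td /t shear_affine_in_z; last exact: Fk.
  by rewrite mulr1 addrC addKr.
apply: (IH F'); rewrite ?F'E //; last by rewrite iterS F'E.
apply: inWB => //; apply: inW_shear => //; first by rewrite msize1.
by rewrite -mpolyC1 derivationC.
Qed.

Lemma inW_mderiv F : inW F -> (F^`M(z))^`M(z) = 0 -> inW F^`M(z).
Proof.
move=> WF Fzz; have -> : F^`M(z) = shear z 1 F - F.
  by rewrite shear_affine_in_z // mulr1 addrC addKr.
apply: inWB => //; apply: inW_shear => //; first by rewrite msize1.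
  by rewrite -mpolyC1 mderivC.
by rewrite -mpolyC1 derivationC.
Qed.

End AffineForms.

(** * The case of affine D(x_i) and of F with constant slope e in the last variable *)

Section AffineDerivation.

Variables (K : fieldType) (n : nat).
Hypothesis charK0 : [pchar K] =i pred0.
Hypothesis n_ge3 : (3 <= n)%N.
Local Notation A := {mpoly K[n]}.
Variables (S : endo K n -> Prop).
Hypothesis affS : forall theta, Aff theta -> S theta.
Variables (D : {linear A -> A}) (nilD : locally_nilpotent D).
Hypothesis derD : derivation D.
Hypothesis triD : forall i j : 'I_n, (i <= j)%N -> (D 'X_i)^`M(j) = 0.
Hypothesis affD : forall i, (msize (D 'X_i) <= 2)%N.
Variable i1 : 'I_n.
Hypothesis DX1 : (1 < msize (D 'X_i1))%N.
Variable z : 'I_n.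
Hypothesis zE : z.+1 = n.
Variables (F : A) (e : K).
Local Notation inV := (inV S).
Local Notation inG := (inG S).
Local Notation inW := (inW S nilD).
Hypothesis WF : inW F.
Hypothesis FzE : F^`M(z) = e%:MP.
Hypothesis e0 : e != 0.

Lemma leq_last (j : 'I_n) : (j <= z)%N.
Proof. by rewrite -ltnS zE. Qed.

Lemma freeDz i : (D 'X_i)^`M(z) = 0.
Proof. by apply: triD; apply: leq_last. Qed.

(** The product of h and the nonconstant D(x_i1) has degree at least 2, which excludes the affine
    alternative. *)
Lemma inW_nonconst_full h : inW h -> h^`M(z) = 0 -> (1 < msize h)%N -> full S.
Proof.
move=> Wh hz h1.
have [//|/(_ i1)] := affine_or_full charK0 n_ge3 affS derD freeDz Wh hz.
have msize_neq0 (p : A) : (1 < msize p)%N -> p != 0.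
  by rewrite -(mmeasure_poly_eq0 mdeg); case: (msize p).
rewrite msizeM ?msize_neq0 //.
move=> le2.
by have := leq_trans (leq_trans (leq_add h1 DX1) (leqSpred _)) (le2 : (_ < 3)%N).
Qed.

Lemma Fzz0 : (F^`M(z))^`M(z) = 0.
Proof. by rewrite FzE mderivC. Qed.

Lemma affine_kernel_full h : (msize h <= 2)%N -> (1 < msize h)%N ->
  h^`M(z) = 0 -> D h = 0 -> full S.
Proof.
move=> h2 h1 hz Dh; apply: (@inW_nonconst_full (e *: h)).
- have -> : e *: h = shear z h F - F.
    by rewrite (shear_affine_in_z _ Fzz0) FzE mul_mpolyC addrC addKr.
  by apply: inWB => //; apply: inW_shear => //; apply: freeDz.
- by rewrite mderivZ hz scaler0.
- by rewrite msizeZ.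
Qed.

Definition affine_in m (w : A) :=
  (msize w <= 2)%N /\ forall j : 'I_n, (m <= j)%N -> w@_U_(j) = 0.

Lemma affine_inB m w w' : affine_in m w -> affine_in m w' -> affine_in m (w - w').
Proof.
move=> [w2 wm] [w2' wm']; split; first by apply: msizeD_max; rewrite // mmeasureN.
by move=> j mj; rewrite mcoeffB wm // wm' // subr0.
Qed.

Lemma affine_inD m w w' : affine_in m w -> affine_in m w' -> affine_in m (w + w').
Proof.
move=> [w2 wm] [w2' wm']; split; first by apply: msizeD_max.
by move=> j mj; rewrite mcoeffD wm // wm' // addr0.
Qed.

Lemma affine_inZ m c w : affine_in m w -> affine_in m (c *: w).
Proof.
move=> [w2 wm]; split; first exact: leq_trans (msizeZ_le _ _) _.
by move=> j mj; rewrite mcoeffZ wm // mulr0.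
Qed.

Lemma affine_inW m m' w : (m <= m')%N -> affine_in m w -> affine_in m' w.
Proof. by move=> le [w2 wm]; split=> // j /(leq_trans le); apply: wm. Qed.

Lemma affine_inX (j : 'I_n) m : (j < m)%N -> affine_in m 'X_j.
Proof.
move=> jm; split; first by rewrite msizeXU.
by move=> i mi; rewrite mcoeffXU; case: eqP => // ji; move: mi; rewrite -ji leqNgt jm.
Qed.

Lemma affine_in_free m w (j : 'I_n) : affine_in m w -> (m <= j)%N -> w^`M(j) = 0.
Proof. by move=> [w2 wm] mj; rewrite affine_mderiv // wm. Qed.

Lemma affine_inDX (j : 'I_n) : affine_in j (D 'X_j).
Proof.
split=> // i ji; have := mcoeff_mderiv i (D 'X_j) 0%MM.
by rewrite triD // mcoeff0 add0m mnm0E mulr1n.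
Qed.

(* X_[top m] is x_{m-1} for m > 0 and 1 for m = 0. *)
Definition top m : 'X_{1..n} := [multinom (i.+1 == m : nat) | i < n].

Lemma topS (k : 'I_n) : top k.+1 = U_(k)%MM.
Proof. by apply/mnmP=> i; rewrite mnm1E /top mnmE eqSS eq_sym. Qed.

Lemma top0 : top 0 = 0%MM.
Proof. by apply/mnmP=> i; rewrite !mnmE. Qed.

(** The single Jordan block condition: for m > 0, such w are the affine forms in the first m - 1
    variables, and D reaches them from forms in the first m. *)
Definition antiderivable m := forall w, affine_in m w -> w@_(top m) = 0 ->
  exists2 v, affine_in m v & D v = w.

Lemma affine_in0 w : affine_in 0 w -> w = (w@_0)%:MP.
Proof.
move=> [w2 w0]; rewrite {1}(affineE w2) big1 ?addr0 // => j _.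
by rewrite w0 ?scale0r.
Qed.

Lemma antiderivable0 : antiderivable 0.
Proof.
move=> w w0; rewrite top0 => w00; exists 0; last by rewrite linear0 (affine_in0 w0) w00.
by split; rewrite ?msize0 // => j _; rewrite mcoeff0.
Qed.

Lemma msize_gt1 (w : A) (j : 'I_n) : w^`M(j) != 0 -> (1 < msize w)%N.
Proof.
by rewrite ltnNge; apply: contraNN => /msize1_polyC ->; rewrite mderivC.
Qed.

(** If D(x_k) has coefficient 0 at [top k], it has an antiderivative v, and x_k - v is a nonconstant
    affine form in ker D. Otherwise subtracting a multiple of D(x_k) from w reduces the claim to
    k. *)
Lemma antiderivableS (k : 'I_n) : (k < z)%N -> antiderivable k ->
  full S \/ antiderivable k.+1.
Proof.
move=> kz adk; pose c := (D 'X_k)@_(top k).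
have Xk : affine_in k.+1 'X_k by apply: affine_inX.
have [c0|c0] := eqVneq c 0; [left | right].
  have [v vk Dv] := adk _ (affine_inDX k) c0.
  have hk : affine_in k.+1 ('X_k - v) by apply: affine_inB (affine_inW _ vk).
  apply: (@affine_kernel_full ('X_k - v)).
  - exact: hk.1.
  - apply: (@msize_gt1 _ k); rewrite mderivB mderivXU eqxx.
    by rewrite (affine_in_free vk) // subr0 oner_neq0.
  - exact: affine_in_free hk kz.
  - by rewrite linearB /= Dv subrr.
move=> w [w2 wk]; rewrite topS => wk0.
have {}wk : affine_in k w.
  split=> // j; rewrite leq_eqVlt => /predU1P[kj|]; last exact: wk.
  by rewrite -wk0; congr (w@_U_(_)); apply: val_inj.
pose a := w@_(top k) / c.
have [||v vk Dv] := adk (w - a *: D 'X_k).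
- by apply: affine_inB => //; apply/affine_inZ/affine_inDX.
- by rewrite mcoeffB mcoeffZ -/c divfK ?subrr.
exists (v + a *: 'X_k); last by rewrite linearD linearZ /= Dv subrK.
by apply: affine_inD; [exact: affine_inW vk | apply: affine_inZ].
Qed.

Lemma full_or_antiderivable m : (m <= z)%N ->
  full S \/ forall k, (k <= m)%N -> antiderivable k.
Proof.
elim: m => [_|m IH mz].
  by right=> k; rewrite leqn0 => /eqP ->; apply: antiderivable0.
have [|adm] := IH (ltnW mz); first by left.
have mn : (m < n)%N by apply: ltn_trans mz _.
have [|adS] := @antiderivableS (Ordinal mn) mz (adm m (leqnn m)); first by left.
right=> k; rewrite leq_eqVlt => /predU1P[-> //|]; rewrite ltnS; exact: adm.
Qed.

(* Truncation to k variables of a dilation with weights 2^(j+1), up to lower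
   terms, that conjugates D to a multiple of itself. *)
Definition graded k (T : A -> A) :=
  [/\ algmor T, forall j : 'I_n, (k <= j)%N -> T 'X_j = 'X_j,
      forall j : 'I_n, (j < k)%N -> affine_in j (T 'X_j - 2%:R ^+ j.+1 *: 'X_j)
    & forall j : 'I_n, (j < k)%N -> D (T 'X_j) = 2%:R *: T (D 'X_j)].

Lemma gradedX_in k T (j : 'I_n) : graded k T -> (j < k)%N -> affine_in j.+1 (T 'X_j).
Proof.
move=> [_ _ Tlow _] jk; rewrite -[T 'X_j](subrK (2%:R ^+ j.+1 *: 'X_j)).
apply: affine_inD; last exact/affine_inZ/affine_inX.
exact: affine_inW (Tlow j jk).
Qed.

Lemma gradedX_top k T (j : 'I_n) : graded k T -> (j < k)%N ->
  (T 'X_j)@_U_(j) = 2%:R ^+ j.+1.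
Proof.
move=> [_ _ Tlow _] jk; rewrite -[T 'X_j](subrK (2%:R ^+ j.+1 *: 'X_j)).
have [_ /(_ j (leqnn j)) lowj] := Tlow j jk.
by rewrite mcoeffD lowj add0r mcoeffZ mcoeffXU eqxx mulr1.
Qed.

Lemma graded_msize k T j : graded k T -> (msize (T 'X_j) <= 2)%N.
Proof.
move=> gT; have [jk|kj] := ltnP j k; first by have [] := gradedX_in gT jk.
by have [_ -> //] := gT; rewrite msizeXU.
Qed.

(** On affine forms T is triangular with diagonal entry 2^(j+1) at x_j, whence the factor 2^k at
    [top k]. *)
Lemma graded_affine k T w : (k <= n)%N -> graded k T -> affine_in k w ->
  affine_in k (T w) /\ (T w)@_(top k) = 2%:R ^+ k * w@_(top k).
Proof.
move=> kn gT [w2 wk]; have [TA _ _ _] := gT.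
have TwE m : (T w)@_m = w@_0 * (m == 0%MM)%:R +
    \sum_(j < n | (j < k)%N) w@_U_(j) * (T 'X_j)@_m.
  rewrite {1}(affineE w2) (algmorD TA) (algmorC TA) mcoeffD mcoeffC; congr (_ + _).
  rewrite (algmor_sum TA) raddf_sum /= (bigID (fun j : 'I_n => j < k)%N) /=.
  rewrite [X in _ + X]big1 ?addr0 => [|j]; last first.
    by rewrite -leqNgt => kj; rewrite wk // scale0r (algmor0 TA) mcoeff0.
  by apply: eq_bigr => j _; rewrite (algmorZ TA) mcoeffZ.
split; first split.
- by apply: msize_affine => // j; apply: graded_msize gT.
- move=> i ki; rewrite TwE mnm1_eq0 mulr0 add0r big1 // => j jk.
  by rewrite (gradedX_in gT jk).2 ?mulr0 // (leq_trans jk).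
rewrite TwE; case: k kn gT wk {TwE} => [|k] kn gT wk.
  by rewrite top0 eqxx mulr1 expr0 mul1r big1 ?addr0.
rewrite (topS (Ordinal kn)) mnm1_eq0 mulr0 add0r (bigD1 (Ordinal kn)) //=.
rewrite (gradedX_top gT) // big1 ?addr0 1?mulrC // => j /andP[].
rewrite ltnS leq_eqVlt => /orP[/eqP jk|jk _]; first by rewrite -val_eqE /= jk eqxx.
by rewrite (gradedX_in gT _).2 ?mulr0 // ltnW.
Qed.

(** The new image of x_k is c x_k + r with D r = 2 T(D x_k) - c D x_k. The weight c = 2^(k+1)
    cancels the coefficient at [top k], so that r exists. *)
Lemma graded_exists : (forall k, (k <= z)%N -> antiderivable k) ->
  forall k, (k <= n)%N -> exists T T',
    [/\ graded k T, inG T, algmor T', cancel T T' & cancel T' T].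
Proof.
move=> ad; elim=> [_|k IH kn].
  by exists id, id; split; [split | exact: inG_id | split | |].
have [T [T' [gT GT T'A TK T'K]]] := IH (ltnW kn).
have [TA TX Tlow TD] := gT.
pose k' := Ordinal kn; pose w := D 'X_k'; pose c : K := 2%:R ^+ k.+1.
have c0 : c != 0 by rewrite expf_neq0 // natr_neq0.
have wk : affine_in k w := affine_inDX k'.
have [Twk Twtop] := graded_affine (ltnW kn) gT wk.
have [|||r rk Dr] := ad k _ (2%:R *: T w - c *: w).
- by rewrite -ltnS zE.
- by apply: affine_inB; apply: affine_inZ.
- by rewrite mcoeffB !mcoeffZ Twtop /c exprS mulrA subrr.
have rfree : r^`M(k') = 0 by apply: affine_in_free rk _.
have cr2 : (msize (c^-1 *: r) <= 2)%N by apply: leq_trans (msizeZ_le _ _) rk.1.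
have crfree : (c^-1 *: r)^`M(k') = 0 by rewrite mderivZ rfree scaler0.
have scA := algmor_shear charK0 k' (c^-1 *: r).
pose E := shear k' (c^-1 *: r) \o dilation k' c.
pose E' := dilation k' c^-1 \o shear k' (- (c^-1 *: r)).
have EA : algmor E by apply: algmor_comp => //; apply: algmor_dilation.
have dK : cancel (dilation k' c) (dilation k' c^-1) by apply: dilationK; rewrite ?mulVf.
have dNK : cancel (dilation k' c^-1) (dilation k' c) by apply: dilationK; rewrite ?mulfV.
have E'A : algmor E'.
  by apply: algmor_comp; [apply: algmor_dilation | apply: algmor_shear].
have EK : cancel E E' by move=> p; rewrite /E /E' /= shearK ?dK.
have E'K : cancel E' E by move=> p; rewrite /E /E' /= dNK shearNK.
have GE : inG E.
  apply: inG_comp; last exact: inG_dilation.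
  by have [] := inV_aff charK0 affS crfree cr2.
have Efree p : p^`M(k') = 0 -> E p = p.
  by move=> pk; rewrite /E /= /dilation !shear_free.
have EX : E 'X_k' = c *: 'X_k' + r.
  rewrite /E /= dilationX // eqxx (algmorZ scA) shearX_eq // scalerDr.
  by rewrite scalerA divff // scale1r.
have ETX (j : 'I_n) : (j < k)%N -> E (T 'X_j) = T 'X_j.
  by move=> jk; apply: Efree; apply: affine_in_free (gradedX_in gT jk) _.
have ETXk : E (T 'X_k') = c *: 'X_k' + r by rewrite TX.
exists (E \o T), (T' \o E'); split; first split.
- exact: algmor_comp.
- move=> j kj /=; rewrite TX ?(ltnW kj) // Efree // free_X //.
  by rewrite -val_eqE /= gtn_eqF.
- move=> j; rewrite ltnS leq_eqVlt => /predU1P[jk|jk] /=; last first.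
    by rewrite ETX //; apply: Tlow.
  have -> : j = k' by apply: val_inj.
  by rewrite ETXk addrAC [X in X + r](subrr (c *: 'X_k')) add0r.
- move=> j; rewrite ltnS leq_eqVlt => /predU1P[jk|jk] /=; last first.
    rewrite ETX // TD //; congr (_ *: _); symmetry; apply: Efree.
    have wj : affine_in k (D 'X_j) by apply: affine_inW (affine_inDX j); apply: ltnW.
    exact: affine_in_free (graded_affine (ltnW kn) gT wj).1 _.
  have -> : j = k' by apply: val_inj.
  rewrite ETXk linearD linearZ /= Dr addrC subrK.
  by congr (_ *: _); symmetry; apply: Efree; apply: affine_in_free Twk _.
- exact: inG_comp.
- exact: algmor_comp.
- by move=> p /=; rewrite EK TK.
- by move=> p /=; rewrite T'K E'K.
Qed.

Lemma affine_in1 (w : A) (j : 'I_n) : j = 0%N :> nat -> affine_in 1 w ->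
  w = (w@_0)%:MP + w@_U_(j) *: 'X_j.
Proof.
move=> j0 [w2 w1]; rewrite {1}(affineE w2) (bigD1 j) //= big1 ?addr0 // => i ij.
rewrite w1 ?scale0r // lt0n; apply: contraNneq ij => i0.
by rewrite -val_eqE /= i0 j0.
Qed.

(* x_z |-> x_z - x_0 / (e c), chosen so that its composite Theta with exp(FD)
   satisfies Theta d/dx_z = - e D Theta: shears in the direction of x_z are
   conjugated by Theta into exponentials of multiples of D. *)
Section Theta.

Variables (x0 : 'I_n) (c : K).
Hypothesis DX0 : D 'X_x0 = c%:MP.
Hypothesis c0 : c != 0.
Hypothesis x0z : x0 != z.

Let h : A := (- (e * c)^-1) *: 'X_x0.
Definition Theta : A -> A := shear z h \o expD nilD F.

Let hz : h^`M(z) = 0.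
Proof. by rewrite mderivZ free_X ?scaler0. Qed.

(** Two chain rules express D(Theta p) by Theta(D p) and Theta(dp/dx_z); as D h = -1/e, the two
    terms in D p cancel. *)
Lemma Theta_mderiv p : Theta p^`M(z) = (- e) *: D (Theta p).
Proof.
have sA := algmor_shear charK0 z h.
have Dh : D h = (- e^-1)%:MP.
  rewrite linearZ /= DX0 -mul_mpolyC -mpolyCM invfM mulNr -mulrA mulVf //.
  by rewrite mulr1.
rewrite /Theta /= {2}/shear (expD_chain charK0) //; last first.
  by move=> q /=; rewrite (freeD_comm derD freeDz).
rewrite (expD_D charK0 nilD derD _ WF.1) /=.
rewrite (expD_chain charK0 nilD _ _ (mderiv_derivation z)); last first.
  by move=> q /=; rewrite (freeD_comm derD freeDz).
rewrite -!/(shear z h _) /= FzE Dh (algmorD sA) (algmorM sA) (algmorC sA).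
rewrite -mul_mpolyC !mpolyCN.
have : e%:MP * (e^-1)%:MP = 1 :> A by rewrite -mpolyCM divff.
move: (shear z h _) (shear z h _) (e%:MP) ((e^-1)%:MP) => t s E I EI.
have -> : - E * (t + - I * (s + E * t)) = (E * I) * s - E * t * (1 - E * I) by ring.
by rewrite EI; ring.
Qed.

Lemma inW_Theta t l : l^`M(z) = 0 -> (msize l <= 2)%N -> inW (t *: Theta l).
Proof.
move=> lz l2; have DF := WF.1.
have ThA : algmor Theta by apply: algmor_comp; [apply: algmor_shear | apply: algmor_expD].
pose Th' := expD nilD (- F) \o shear z (- h).
have Th'A : algmor Th' by apply: algmor_comp; [apply: algmor_expD | apply: algmor_shear].
have h2 : (msize h <= 2)%N by apply: leq_trans (msizeZ_le _ _) _; rewrite msizeXU.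
have ThK : cancel Theta Th' by move=> p; rewrite /Theta /Th' /= shearK // expDK.
have Th'K : cancel Th' Theta by move=> p; rewrite /Theta /Th' /= expDNK // shearNK.
have GT : inG Theta.
  by apply: inG_comp WF.2; have [] := inV_aff charK0 affS hz h2.
have -> : t *: Theta l = (- e) *: Theta ((- (t / e)) *: l).
  by rewrite (algmorZ ThA) scalerA mulrNN mulrCA divff ?mulr1.
set l' := _ *: l; have l'z : l'^`M(z) = 0 by rewrite mderivZ lz scaler0.
have l'2 : (msize l' <= 2)%N by apply: leq_trans (msizeZ_le _ _) _.
split; first by rewrite linearZ /= -Theta_mderiv l'z (algmor0 ThA).
have Gl : inG (shear z l') by have [] := inV_aff charK0 affS l'z l'2.
apply: eq_inG (inG_conj GT Th'A ThK Th'K Gl) => p /=.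
rewrite (@expD_intertwine _ _ (mderiv z) D (@mderiv_nilpotent K n z) nilD Theta (- e)) //.
  by rewrite -/(Theta (Th' p)) Th'K.
exact: Theta_mderiv.
Qed.

Let sF : shear z h F = F - c^-1 *: 'X_x0.
Proof.
rewrite shear_affine_in_z ?Fzz0 // FzE mul_mpolyC /h scaleNr scalerN scalerA.
by rewrite invfM mulrA divff ?mul1r.
Qed.

(** exp(FD) gives x_0 + c F, and the shear lowers F by x_0 / c, which cancels x_0. *)
Lemma ThetaX0 : Theta 'X_x0 = c *: F.
Proof.
have sA := algmor_shear charK0 z h.
rewrite /Theta /= (@expDE _ _ _ _ 2) /= ?DX0 ?derivationC //.
rewrite 2!big_ord_recr big_ord0 /= add0r divD0 expr0 mulr1 expr1.
rewrite /divD /= invr1 scale1r DX0 mul_mpolyC (algmorD sA) (algmorZ sA) sF.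
by rewrite shearX_neq // scalerBr scalerA divff // scale1r addrC subrK.
Qed.

(** The mixed terms in x_0 F cancel, which separates a polynomial in x_0 and x_1 from one in F. *)
Lemma ThetaX1 (x1 : 'I_n) a b : x1 != z -> D 'X_x1 = a%:MP + b *: 'X_x0 ->
  Theta 'X_x1 = 'X_x1 - (a / c) *: 'X_x0 - (b / (2%:R * c)) *: 'X_x0 ^+ 2 +
    a *: F + (b * c / 2%:R) *: F ^+ 2.
Proof.
move=> x1z DX_1; have sA := algmor_shear charK0 z h.
have DDX1 : D (D 'X_x1) = (b * c)%:MP.
  by rewrite DX_1 linearD linearZ /= derivationC // add0r DX0 -mul_mpolyC mpolyCM.
rewrite /Theta /= (@expDE _ _ _ _ 3) /= ?DDX1 ?derivationC //.
rewrite 3!big_ord_recr big_ord0 /= add0r divD0 expr0 mulr1 expr1.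
rewrite /divD /= invr1 scale1r DDX1 DX_1 !(algmorD sA) (algmorM sA _ (F ^+ 2)).
rewrite (algmorXn sA) (algmorM sA _ F) !(algmorZ sA, algmorD sA, algmorC sA) sF.
rewrite !shearX_neq // -!mul_mpolyC.
rewrite !mpolyCM.
have two0 : (2%:R : K) != 0 by rewrite natr_neq0.
have -> : (2`!%:R : K) = 2%:R by [].
have cI : c%:MP * (c^-1)%:MP = 1 :> A by rewrite -mpolyCM divff.
have twoI : (2%:R^-1)%:MP + (2%:R^-1)%:MP = 1 :> A.
  by rewrite -mpolyCD -mulr2n -[_ *+ 2]mulr_natr mulVf.
rewrite invfM mpolyCM.
move: (c%:MP) ((c^-1)%:MP) (a%:MP) (b%:MP) ((2%:R^-1)%:MP) cI twoI => C I a' b' H cI HI.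
move: ('X_x0) ('X_x1) F => X Y G.
(* The last two summands vanish by C I = 1 and H + H = 1; with them the identity holds for
   independent letters. *)
transitivity (Y - a' * I * X - b' * (H * I) * X ^+ 2 + a' * G + b' * C * H * G ^+ 2
  + b' * X * G * (1 - (H + H) + (H + H) * (1 - C * I))
  + b' * I * X ^+ 2 * (H + H - 1 - H * (1 - C * I))); first ring.
by rewrite cI HI; ring.
Qed.

End Theta.

Lemma inW_half T T' H : graded n T -> inG T -> algmor T' -> cancel T T' ->
  cancel T' T -> inW H -> inW (2%:R^-1 *: T H).
Proof.
move=> [TA _ _ TD] GT T'A TK T'K; apply: inW_conj GT T'A TK T'K _ => //.
apply: intertwine_X => // j.
by rewrite TD // scalerA mulVf ?scale1r // natr_neq0.
Qed.

Lemma affine_derivation_full : full S.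
Proof.
have [//|ad] := full_or_antiderivable (leqnn z).
have n0 : (0 < n)%N by apply: leq_trans n_ge3.
have n1 : (1 < n)%N by apply: leq_trans n_ge3.
pose x0 := Ordinal n0; pose x1 := Ordinal n1.
have x0z : x0 != z by rewrite -val_eqE /=; move: zE n_ge3; lia.
have x1z : x1 != z by rewrite -val_eqE /=; move: zE n_ge3; lia.
have x01 : x0 != x1 by [].
pose c := (D 'X_x0)@_0.
have DX0 : D 'X_x0 = c%:MP by apply: affine_in0; apply: (affine_inDX x0).
have [c0|c0] := eqVneq c 0.
  apply: (@affine_kernel_full 'X_x0); rewrite ?msizeXU ?free_X //.
  by rewrite DX0 c0.
pose a := (D 'X_x1)@_0; pose b := (D 'X_x1)@_U_(x0).
have DX1' : D 'X_x1 = a%:MP + b *: 'X_x0.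
  by apply: affine_in1 => //; apply: (affine_inDX x1).
have [b0|b0] := eqVneq b 0.
  apply: (@affine_kernel_full ('X_x1 - (a / c) *: 'X_x0)).
  - apply: msizeD_max; rewrite ?msizeXU // mmeasureN.
    by apply: leq_trans (msizeZ_le _ _) _; rewrite msizeXU.
  - apply: (@msize_gt1 _ x1); rewrite mderivB mderivZ mderivXU eqxx free_X //.
    by rewrite scaler0 subr0 oner_neq0.
  - by rewrite mderivB mderivZ !free_X // scaler0 subr0.
  - rewrite linearB linearZ /= DX0 DX1' b0 scale0r addr0 -mul_mpolyC -mpolyCM.
    by rewrite divfK // subrr.
have WtF t : inW (t *: F).
  have := inW_Theta DX0 c0 x0z (t / c) (free_X _ x0z) (_ : _ <= 2)%N.
  rewrite msizeXU => /(_ isT).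
  by rewrite (ThetaX0 DX0 c0 x0z) scalerA divfK.
pose f2 := 'X_x1 - (a / c) *: 'X_x0 - (b / (2%:R * c)) *: 'X_x0 ^+ 2.
pose k := b * c / 2%:R.
have WtN t : inW (t *: (f2 + k *: F ^+ 2)).
  have := inW_Theta DX0 c0 x0z t (free_X _ x1z) (_ : _ <= 2)%N.
  rewrite msizeXU => /(_ isT).
  rewrite (ThetaX1 DX0 c0 x0z x1z DX1') -/f2 -/k.
  move=> WN; have := inWB charK0 derD WN (WtF (t * a)); congr inW.
  by rewrite -scalerA -scalerBr addrAC addrK.
have [T [T' [gT GT T'A TK T'K]]] := graded_exists ad (leqnn n).
have [TA _ _ TD] := gT.
have WT H : inW H -> inW (T H).
  move=> WH; have := inWMn charK0 derD 2 (inW_half gT GT T'A TK T'K WH).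
  by rewrite scalerA divff ?scale1r // natr_neq0.
pose q : K := 2%:R ^+ n.
have TXfree (j i : 'I_n) : (j < i)%N -> (T 'X_j)^`M(i) = 0.
  by move=> ji; apply: affine_in_free (gradedX_in gT (ltn_ord j)) ji.
have TXdiag (j : 'I_n) : (T 'X_j)^`M(j) = (2%:R ^+ j.+1)%:MP.
  by rewrite affine_mderiv ?(graded_msize j gT) // (gradedX_top gT).
(* T multiplies x_z by q up to earlier variables, so T F - q F will be free of x_z. *)
have TFz : (T F)^`M(z) = (q * e)%:MP.
  have q0 : q != 0 by rewrite expf_neq0 // natr_neq0.
  have Tz p : T p^`M(z) = q^-1 *: (T p)^`M(z).
    move: p; apply: intertwine_X => //; try exact: mderiv_derivation.
    move=> j /=; rewrite mderivXU; case: eqP => [->|/eqP jz].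
      by rewrite (algmor1 TA) TXdiag zE -mul_mpolyC -mpolyCM mulVf.
    rewrite (algmor0 TA) TXfree ?scaler0 //.
    by rewrite ltn_neqAle val_eqE jz leq_last.
  have := Tz F; rewrite FzE (algmorC TA) => /(congr1 ( *:%R q)).
  by rewrite scalerA divff // scale1r -mul_mpolyC mpolyCM => ->.
have [u1|] := leqP (msize (T F - q *: F)) 1; last first.
  apply: inW_nonconst_full; first exact: inWB (WT _ WF) (WtF q).
  by rewrite mderivB TFz mderivZ FzE -mul_mpolyC mpolyCM subrr.
pose k0 := (T F - q *: F)@_0.
have TFE : T F = q *: F + k0%:MP.
  by rewrite -(msize1_polyC u1) addrC subrK.
(* With N = f2 + k F^2, this is T N - q^2 N - 2 k q k0 F: as T F = q F + k0, all powers of F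
   cancel. *)
pose v := T f2 - q ^+ 2 *: f2 + (k * k0 ^+ 2)%:MP.
have Wv : inW v.
  have := inWB charK0 derD (inWB charK0 derD (WT _ (WtN 1)) (WtN (q ^+ 2)))
    (WtF (k * q * k0 * 2%:R)).
  congr inW; rewrite scale1r (algmorD TA) (algmorZ TA) (algmorXn TA) TFE /v.
  move: (T f2) => g; rewrite -!mul_mpolyC !mpolyCM !rmorphXn /=.
  rewrite (rmorph_nat (@mpolyC n K)); ring.
have free2 i : x0 != i -> (('X_x0 : A) ^+ 2)^`M(i) = 0.
  by move=> xi; rewrite expr2 mderivM free_X // mulr0 mul0r addr0.
have TX0free i : x0 != i -> (T 'X_x0)^`M(i) = 0.
  move=> xi; apply: TXfree; rewrite lt0n; apply: contraNneq xi => i0.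
  by rewrite -val_eqE /= i0.
have Tfree2 i : x0 != i -> (T ('X_x0 ^+ 2))^`M(i) = 0.
  by move=> xi; rewrite (algmorXn TA) expr2 mderivM TX0free // mulr0 mul0r addr0.
have f2i i : x0 != i -> f2^`M(i) = 'X_x1^`M(i).
  move=> xi; rewrite /f2 !mderivB !mderivZ (free_X _ xi) free2 // !scaler0.
  by rewrite !subr0.
have Tf2i i : x0 != i -> (T f2)^`M(i) = (T 'X_x1)^`M(i).
  move=> xi; rewrite /f2 !(algmorB TA) !(algmorZ TA) !mderivB !mderivZ Tfree2 //.
  by rewrite TX0free // !scaler0 !subr0.
have vi i : x0 != i -> v^`M(i) = (T 'X_x1)^`M(i) - q ^+ 2 *: 'X_x1^`M(i).
  move=> xi; rewrite /v mderivD mderivC addr0 mderivB mderivZ f2i // Tf2i //.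
apply: (inW_nonconst_full Wv).
  rewrite vi // free_X // TXfree ?scaler0 ?subr0 //.
  by move: zE n_ge3 => /=; lia.
(* The derivative of v along x_1 is 2^2 - 2^(2n), which is nonzero. *)
apply: (@msize_gt1 _ x1); rewrite vi // TXdiag mderivXU eqxx.
rewrite -mul_mpolyC mulr1 -mpolyCB mpolyC_eq0 /q subr_eq0 -exprM -!natrX.
apply/negP=> /eqP/(natr_inj charK0)/eqP; rewrite eqn_exp2l //=.
by move: n_ge3; lia.
Qed.

End AffineDerivation.

(** * The case distinction for triangular derivations, and the truncated exponential series *)

Section TriangularDerivation.

Variables (K : fieldType) (n : nat).
Hypothesis charK0 : [pchar K] =i pred0.
Hypothesis n_ge3 : (3 <= n)%N.
Local Notation A := {mpoly K[n]}.
Variables (D : {linear A -> A}) (nilD : locally_nilpotent D).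
Hypothesis derD : derivation D.

Lemma triangular_affine_or_full (S : endo K n -> Prop) F :
  (forall theta, Aff theta -> S theta) -> triangular D -> inW S nilD F ->
  full S \/ forall i, (msize (F * D 'X_i) <= 2)%N.
Proof.
move=> affS triD WF.
have triD' (i j : 'I_n) : (i <= j)%N -> (D 'X_i)^`M(j) = 0.
  exact: in_first_vars_free (triD i).
have zn : (n.-1 < n)%N by lia.
pose z := Ordinal zn; have zE : z.+1 = n by rewrite /= prednK //; lia.
have freeD : forall i, (D 'X_i)^`M(z) = 0.
  by move=> i; apply: triD'; rewrite -ltnS zE.
have [Fz|Fz] := eqVneq F^`M(z) 0; first exact: (affine_or_full _ _ affS derD freeD).
have [/forallP cstD|] := boolP [forall i, msize (D 'X_i) <= 1]%N.
  apply: (@inW_constant_coef _ _ charK0 _ affS n_ge3 _ nilD derD (fun i => (D 'X_i)@_0)) WF => i.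
  exact: msize1_polyC.
rewrite negb_forall => /existsP[i1]; rewrite -ltnNge => DX1; left.
have [F1 [WF1 F1z F1zz]] := inW_degree1 charK0 affS derD freeD WF Fz.
have Wf := inW_mderiv charK0 affS derD freeD WF1 F1zz.
have [//|fD] := affine_or_full charK0 n_ge3 affS derD freeD Wf F1zz.
have DX1_neq0 : D 'X_i1 != 0.
  by rewrite -(mmeasure_poly_eq0 mdeg); case: (msize _) DX1.
(* Its product with the nonconstant D(x_i1) is affine, so the slope of F1 is a constant, and D is
   then affine on the variables. *)
have f1 : (msize F1^`M(z) <= 1)%N.
  rewrite leqNgt; apply: contraTN (fD i1) => f2; rewrite msizeM // -ltnNge.
  by have := leq_trans (leq_add f2 DX1) (leqSpred _).
have fE := msize1_polyC f1; set e := _@_0 in fE.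
have e0 : e != 0 by apply: contraNneq F1z => e0; rewrite fE e0.
apply: (affine_derivation_full charK0 n_ge3 affS derD triD' _ DX1 zE WF1 fE e0) => i.
by have := fD i; rewrite fE mul_mpolyC msizeZ.
Qed.

(** As F is in ker D, (FD)^k = F^k D^k. The two truncations of the series are compared at a common
    bound, where the added terms are zero. *)
Lemma tup_expD F (kerF : D F = 0) :
  exp_endo (locally_nilpotent_mul derD nilD kerF) = tup (expD nilD F).
Proof.
apply: eq_from_tnth => r; rewrite !tnth_mktuple; case: ex_minnP => N /eqP FN _.
have iterFD k : iter k (F \*o D) 'X_r = F ^+ k * iter k D 'X_r.
  elim: k => [|k IH]; first by rewrite expr0 mul1r.
  by rewrite iterS IH /= derD (derivationX0 k derD kerF) mul0r add0r exprS mulrA.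
have [M /eqP DM] := nilD 'X_r.
rewrite (@expDE _ _ _ _ (maxn N M)); last first.
  by apply: iterD_ge DM _; rewrite leq_maxr.
rewrite (big_ord_widen (maxn N M) (fun i => (i`!%:R)^-1 *: iter i (F \*o D) 'X_r)) ?leq_maxl //.
rewrite big_mkcond /=; apply: eq_bigr => k _.
rewrite /divD -scalerAl [_ * F ^+ k]mulrC -iterFD; case: ltnP => // Nk.
by rewrite (iterD_ge (D := F \*o D) FN Nk) scaler0.
Qed.

End TriangularDerivation.

Theorem theorem12 (K : fieldType) (charK0 : [pchar K] =i pred0)
    (n : nat) (n_ge3 : (3 <= n)%N)
    (D : {linear {mpoly K[n]} -> {mpoly K[n]}})
    (derD : derivation D) (triD : triangular D) (nilD : locally_nilpotent D)
    (F : {mpoly K[n]}) (kerF : D F = 0) :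
  let phi := exp_endo (locally_nilpotent_mul derD nilD kerF) in
  Aff phi \/ cotame phi.
Proof.
move=> phi; have phiE : phi = tup (expD nilD F) := tup_expD nilD derD kerF.
pose S (theta : endo K n) := theta = phi \/ Aff theta.
have expA H := algmor_expD charK0 nilD derD H.
have WF : inW S nilD F.
  by split=> //; split=> //; rewrite -phiE; apply: generated_mem; left.
have affS (theta : endo K n) : Aff theta -> S theta by right.
have [fullS|affF] := triangular_affine_or_full charK0 n_ge3 derD affS triD WF.
  right; split; last by move=> psi; apply: full_TA.
  exists (tup (expD nilD (- F))); rewrite phiE; apply: tup_inverse => //.
  - exact: expDK.
  - exact: expDNK.
by left; rewrite phiE; apply: Aff_expD.
Qed.
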